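(* Let $X$ be a finite set and $>$ a monomial-center ordering on $\lfloor X^+\rfloor_1\cup\lfloor XX\rfloor_2$. Then the following algorithm, applied to a finite Gröbner--Shirshov basis $S=\{g_1,\dots,g_n\}$ in $Di[X]$, terminates after finitely many steps and returns the reduced Gröbner--Shirshov basis $RG$ in $Di[X]$ for $Id(S)$. Algorithm. Put $C:=S$. For each $f\in C$: set $S:=S\setminus\{f\}$, and if $f$ is not partially reducible by $S$, set $S:=S\cup\{f\}$. Then put $RG:=\emptyset$ and, for each $h\in S$: set $G:=S\setminus\{h\}$, let $r$ be a remainder of $h$ modulo $G$, and if $r\neq0$ set $RG:=RG\cup\{r\}$. Return $RG$.
   Context: Fix a field $\mathbf{k}$. A commutative dialgebra is a $\mathbf{k}$-linear space with two bilinear operations $\vdash,\dashv$, each associative and commutative, satisfying $a\dashv(b\vdash c)=a\dashv(b\dashv c)$, $(a\dashv b)\vdash c=(a\vdash b)\vdash c$, $a\vdash(b\dashv c)=(a\vdash b)\dashv c$. An ideal is a subspace closed under multiplication (by $\vdash$ and by $\dashv$) with arbitrary elements; $Id(S)$ is the ideal generated by $S$. Let $X$ be a totally ordered set, $\lfloor X^+\rfloor$ the free commutative semigroup without unit on $X$ (elements $\lfloor u\rfloor$, length $|u|$), $\lfloor X^*\rfloor=\lfloor X^+\rfloor\cup\{\varepsilon\}$ the free commutative monoid. Let $\lfloor X^+\rfloor_1=\{\lfloor u\rfloor_1\mid\lfloor u\rfloor\in\lfloor X^+\rfloor\}$ and $\lfloor XX\rfloor_2=\{\lfloor v\rfloor_2\mid\lfloor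 v\rfloor\in\lfloor X^+\rfloor,|v|=2\}$ (formal symbols); $x\in X$ is identified with $\lfloor x\rfloor_1$. $Di[X]$ is the free commutative dialgebra generated by $X$: the $\mathbf{k}$-space with basis $\lfloor X^+\rfloor_1\cup\lfloor XX\rfloor_2$ and operations: for $x,x'\in X$, $x\dashv x'=\lfloor xx'\rfloor_1$, $x\vdash x'=\lfloor xx'\rfloor_2$; and if $|uv|>2$, $\lfloor u\rfloor_p\vdash\lfloor v\rfloor_q=\lfloor u\rfloor_p\dashv\lfloor v\rfloor_q=\lfloor uv\rfloor_1$. Ordering. A monomial ordering on $\lfloor X^+\rfloor$ is a well (total) ordering with $\lfloor u\rfloor>\lfloor v\rfloor\Rightarrow\lfloor uw\rfloor>\lfloor vw\rfloor$. The associated monomial-center ordering on $\lfloor X^+\rfloor_1\cup\lfloor XX\rfloor_2$ is: $\lfloor u\rfloor_m>\lfloor v\rfloor_n$ iff $(\lfloor u\rfloor,m)>(\lfloor v\rfloor,n)$ lexicographically. For nonzero $f\in Di[X]$: $supp(f)$ is the set of basis elements occurring with nonzero coefficient; $\overline f$ its largest element (leading monomial), $lc(f)$ its coefficient; $\widetilde f\in\lfloor X^+\rfloor$ is the word $\lfloor u\rfloor$ if $\overline f=\lfloor u\rfloor_m$; $r_f=f-lc(f)\overline f$. Convention: $\overline 0=\widetilde 0=0$ is smaller than everything. $f$ is monic if $lc(f)=1$; a set is monic if all its elements are. $f\ne0$ is strong if $\widetilde f>\widetilde{r_f}$. Normal polynomials. For a monic set $S$ the normal $S$-polynomials (normal $s$-polynomials,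 $s\in S$) $\lfloor sb\rfloor_m$ ($\lfloor b\rfloor\in\lfloor X^*\rfloor$, $m\in\{1,2\}$) are: $\lfloor sb\rfloor_m=s$ if $b=\varepsilon$ ($m$ being the index of $\overline s$); $\lfloor sb\rfloor_2=s\vdash b$ if $|\widetilde s|=1$ and $b\in X$; $\lfloor sb\rfloor_1=s\dashv\lfloor b\rfloor_1$ if $s$ is strong and $\lfloor b\rfloor\in\lfloor X^+\rfloor$. $Irr(S)$ is the set of elements of $\lfloor X^+\rfloor_1\cup\lfloor XX\rfloor_2$ that are not the leading monomial of any normal $S$-polynomial. Compositions of monic $f,g\in Di[X]$: (i) if $f$ is not strong, for each $x\in X$, $f\vdash x$ and $f\dashv x$; (ii) if $f$ is strong, $|\widetilde f|>1$ and $supp(f)\cap X\ne\emptyset$, for each $x\in X$, $(f\vdash x)-(f\dashv x)$; (iii) if $f\neq g$, $\overline f=\overline g$: $f-g$; (iv) if $|\widetilde f|=2$, $|\widetilde g|=1$ and there is a normal $g$-polynomial $\lfloor gx\rfloor_m$, $x\in X$, with $\overline f=\overline{\lfloor gx\rfloor_m}$: $f-\lfloor gx\rfloor_m$; (v) if $f,g$ are strong, $|\widetilde f|+|\widetilde g|>3$, $\overline f\ne\overline g$: when $\widetilde f=\widetilde g$, for each $x\in X$, $\lfloor fx\rfloor_1-\lfloor gx\rfloor_1$; when $\widetilde f\neq\widetilde g$ and $lcm\{\widetilde f,\widetilde g\}=\lfloor w\rfloor=\lfloor\widetilde fa\rfloor=\lfloor\widetilde gb\rfloor$ with $\lfloor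 a\rfloor\in\lfloor X^*\rfloor$, $\lfloor b\rfloor\in\lfloor X^+\rfloor$, $|w|<|\widetilde f|+|\widetilde g|$: $\lfloor fa\rfloor_1-\lfloor gb\rfloor_1$. $h\in Di[X]$ is trivial modulo $S$ if $h=\sum_i\alpha_i\lfloor s_ib_i\rfloor_{m_i}$ (finite sum, $\alpha_i\in\mathbf{k}$, normal $S$-polynomials) with $\overline{\lfloor s_ib_i\rfloor_{m_i}}\le\overline h$ whenever $\alpha_i\ne0$. A monic set $S$ is a Gröbner--Shirshov basis in $Di[X]$ if every composition of polynomials in $S$ is trivial modulo $S$; it is then called a Gröbner--Shirshov basis for $Id(S)$. It is reduced if $supp(s)\subseteq Irr(S\setminus\{s\})$ for every $s\in S$. Reduction. A nonzero $f$ is reducible by $S$ if some $\lfloor u\rfloor_m\in supp(f)$ equals $\overline{\lfloor gb\rfloor_m}$ for a normal $g$-polynomial $\lfloor gb\rfloor_m$, $g\in S$; then, with $\alpha$ the coefficient of $\lfloor u\rfloor_m$ in $f$, replacing $f$ by $f-\frac{\alpha}{lc(g)}\lfloor gb\rfloor_m$ is a one-step-reduction by $S$. $f$ is partially reducible by $S$ if $\overline f=\overline{\lfloor gb\rfloor_m}$ for some $g\in S$ and normal $g$-polynomial $\lfloor gb\rfloor_m$. A remainder of $f$ modulo $S$ is an element obtained from $f$ by finitely many one-step-reductions by $S$ that is not reducible by $S$ (0 is not reducible). *)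

(* Defs.v *)
From HB Require Import structures.
From mathcomp Require Import all_boot all_order all_algebra finmap.
From mathcomp Require Import multinomials.monalg.
From Stdlib Require Import Relation_Operators.

Set Implicit Arguments.
Unset Strict Implicit.
Unset Printing Implicit Defensive.

Import GRing.Theory.
Local Open Scope fset_scope.
Local Open Scope ring_scope.

(* Commutative words: [{cmonom X}] is the free commutative monoid, with unit
   [mone], product [mmul], generators [ucm x] and length [mdeg]. *)
Section Words.
Variable X : choiceType.

(* The free commutative semigroup without unit. *)
Record word := Word { word_val :> {cmonom X}; _ : (0 < mdeg word_val)%N }.
HB.instance Definition _ := [isSub for word_val].
HB.instance Definition _ := [Choice of word by <:].

Record word2 := Word2 { word2_val :> {cmonom X}; _ : mdeg word2_val == 2%N }.
HB.instance Definition _ := [isSub for word2_val].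
HB.instance Definition _ := [Choice of word2 by <:].

Fact word2_word_subproof (v : word2) : (0 < mdeg v)%N.
Proof. by case: v => v /= /eqP ->. Qed.
Definition word2_word (v : word2) : word := Word (word2_word_subproof v).

Fact word_mul_subproof (u v : word) : (0 < mdeg (mmul (u : {cmonom X}) v))%N.
Proof. by rewrite mdegM addn_gt0 (valP u). Qed.
Definition word_mul (u v : word) : word := Word (word_mul_subproof u v).

Fact word_gen_subproof (x : X) : (0 < mdeg (ucm x))%N.
Proof. by rewrite mdegU. Qed.
Definition word_gen (x : X) : word := Word (word_gen_subproof x).

(* [inl u] is the symbol "u with index 1", [inr v] is "v with index 2". *)
Definition basis := (word + word2)%type.
HB.instance Definition _ := Choice.on basis.

Definition bword (a : basis) : word :=
  match a with inl u => u | inr v => word2_word v end.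
Definition bindex (a : basis) : nat :=
  match a with inl _ => 1%N | inr _ => 2%N end.

Definition bdashv (a b : basis) : basis := inl (word_mul (bword a) (bword b)).

(* Index 2 exactly when the product has length 2, i.e. when both factors are
   generators; [insub] tests for length 2. *)
Definition bvdash (a b : basis) : basis :=
  let w := word_mul (bword a) (bword b) in
  oapp inr (inl w) (insub (word_val w) : option word2).

Definition divides (u w : {cmonom X}) : Prop := exists c, w = mmul u c.
Definition is_lcm (u v w : {cmonom X}) : Prop :=
  [/\ divides u w, divides v w
    & forall w', divides u w' -> divides v w' -> divides w w'].

Record monomial_order (lt : rel word) : Prop := MonomialOrder {
  mo_irr : irreflexive lt;
  mo_trans : transitive lt;
  mo_total : forall u v, u != v -> lt u v || lt v u;
  mo_wf : well_founded (fun u v => lt u v);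
  mo_mul : forall u v w, lt v u -> lt (word_mul v w) (word_mul u w) }.

(* The monomial-center ordering associated with [lt]. *)
Definition basis_lt (lt : rel word) : rel basis := fun a b =>
  lt (bword a) (bword b)
  || (bword a == bword b) && (bindex a < bindex b)%N.

End Words.

(* [None] plays the role of the leading monomial (or word) of the zero
   polynomial: it lies below everything. *)
Definition opt_lt (T : Type) (r : rel T) : rel (option T) := fun x y =>
  match x, y with
  | _, None => false
  | None, Some _ => true
  | Some a, Some b => r a b
  end.

(* The free commutative dialgebra Di[X]. *)
Notation Di k X := {malg k[basis X]}.

Section Dialgebra.
Variables (k : fieldType) (X : choiceType).
Local Notation D := (Di k X).
Implicit Types (f g h s p q r : D) (S I : D -> Prop) (x y : X).

Definition bilin (op : basis X -> basis X -> basis X) f g : D :=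
  \sum_(a <- msupp f) \sum_(b <- msupp g) << f@_a * g@_b *g op a b >>.
Definition vdash := bilin (@bvdash X).
Definition dashv := bilin (@bdashv X).

Definition word1 (u : word X) : D := << inl u : basis X >>.
Definition gen x : D := word1 (word_gen x).

Record is_ideal I : Prop := IsIdeal {
  ideal0 : I 0;
  idealD : forall f g, I f -> I g -> I (f + g);
  idealZ : forall (c : k) f, I f -> I (c *: f);
  ideal_vdash : forall f g, I f -> I (vdash f g) /\ I (vdash g f);
  ideal_dashv : forall f g, I f -> I (dashv f g) /\ I (dashv g f) }.

Definition Id S : D -> Prop := fun f =>
  forall I, is_ideal I -> (forall s, S s -> I s) -> I f.

Variable lt : rel (word X).
Local Notation blt := (opt_lt (basis_lt lt)).

Definition lm f : option (basis X) :=
  \big[(fun a b => if blt a b then b else a)/None]_(a <- msupp f) Some a.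
Definition lword f : option (word X) := omap (@bword X) (lm f).
Definition lc f : k := oapp (fun a => f@_a) 0 (lm f).
Definition tail f : D := f - oapp (fun a => << lc f *g a >>) 0 (lm f).
Definition ldeg f : nat := oapp (fun u : word X => mdeg u) 0%N (lword f).
Definition lindex f : nat := oapp (@bindex X) 0%N (lm f).

Definition lm_le (a b : option (basis X)) : bool := (a == b) || blt a b.

Definition monic S : Prop := forall s, S s -> lc s = 1.

Definition strong f : bool :=
  (f != 0) && opt_lt lt (lword (tail f)) (lword f).

(* [normal s b m p]: the normal s-polynomial with parameters b and m is
   defined, and p is its value. *)
Inductive normal s : {cmonom X} -> nat -> D -> Prop :=
| Normal_self : normal s mone (lindex s) s
| Normal_vdash x of ldeg s = 1%N : normal s (ucm x) 2 (vdash s (gen x))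
| Normal_dashv (b : word X) of strong s : normal s b 1 (dashv s (word1 b)).

Definition normal_in S p : Prop := exists s b m, S s /\ normal s b m p.

Definition Irr S : basis X -> Prop := fun a =>
  forall p, normal_in S p -> lm p <> Some a.

Inductive composition f g : D -> Prop :=
| Comp_nonstrong_vdash x of ~~ strong f : composition f g (vdash f (gen x))
| Comp_nonstrong_dashv x of ~~ strong f : composition f g (dashv f (gen x))
| Comp_linear x y of strong f & (1 < ldeg f)%N
    & (inl (word_gen y) : basis X) \in msupp f :
    composition f g (vdash f (gen x) - dashv f (gen x))
| Comp_same of f <> g & lm f = lm g : composition f g (f - g)
| Comp_generator x m p of ldeg f = 2%N & ldeg g = 1%N
    & normal g (ucm x) m p & lm f = lm p :
    composition f g (f - p)
| Comp_same_word x p q of strong f & strong g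
    & (3 < ldeg f + ldeg g)%N & lm f <> lm g & lword f = lword g
    & normal f (ucm x) 1 p & normal g (ucm x) 1 q :
    composition f g (p - q)
| Comp_overlap (u v : word X) (w a b : {cmonom X}) p q
    of strong f & strong g
    & (3 < ldeg f + ldeg g)%N & lm f <> lm g
    & lword f = Some u & lword g = Some v & u <> v
    & is_lcm u v w & w = mmul (u : {cmonom X}) a & w = mmul (v : {cmonom X}) b & b <> mone
    & (mdeg w < ldeg f + ldeg g)%N
    & normal f a 1 p & normal g b 1 q :
    composition f g (p - q).

Definition trivial_mod S h : Prop :=
  exists l : seq (k * D),
    h = \sum_(i <- l) i.1 *: i.2 /\
    forall i, i \in l ->
      normal_in S i.2 /\ (i.1 != 0 -> lm_le (lm i.2) (lm h)).

Definition GSB S : Prop :=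
  monic S /\
  forall f g h, S f -> S g -> composition f g h -> trivial_mod S h.

Definition reduced S : Prop :=
  forall s, S s -> forall a, a \in msupp s -> Irr (fun t => S t /\ t <> s) a.

Definition reduced_GSB_for I S : Prop :=
  [/\ GSB S, reduced S & forall f, Id S f <-> I f].

Definition elements (S : {fset D}) : D -> Prop := fun f => f \in S.

Definition reduction_step (S : {fset D}) f f' : Prop :=
  exists g b m p a,
    [/\ g \in S, normal g b m p, a \in msupp f, lm p = Some a
      & f' = f - (f@_a / lc g) *: p].

Definition reducible (S : {fset D}) f : Prop :=
  exists a p, [/\ a \in msupp f, normal_in (elements S) p & lm p = Some a].

Definition partially_reducible (S : {fset D}) f : Prop :=
  exists a p, [/\ lm f = Some a, normal_in (elements S) p & lm p = Some a].

(* Small-step semantics of the algorithm.  Every choice left open by the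
   pseudo-code (the order in which the loops visit their sets, and each
   one-step-reduction made while computing a remainder) is nondeterministic.
   - [Prune C S]: first loop; C holds the polynomials still to be visited.
   - [Collect H S RG]: second loop; H holds the polynomials still to be
     visited.
   - [Reduce H S RG G r]: body of the second loop, r being the polynomial
     obtained so far by one-step-reductions modulo G. *)
Inductive state :=
| Prune of {fset D} & {fset D}
| Collect of {fset D} & {fset D} & {fset D}
| Reduce of {fset D} & {fset D} & {fset D} & {fset D} & D
| Return of {fset D}.

Inductive step : state -> state -> Prop :=
| Prune_drop (C S : {fset D}) f of f \in C & partially_reducible (S `\ f) f :
    step (Prune C S) (Prune (C `\ f) (S `\ f))
| Prune_keep (C S : {fset D}) f of f \in C & ~ partially_reducible (S `\ f) f :
    step (Prune C S) (Prune (C `\ f) (f |` (S `\ f)))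
| Prune_end (S : {fset D}) : step (Prune fset0 S) (Collect S S fset0)
| Collect_pick (H S RG : {fset D}) h of h \in H :
    step (Collect H S RG) (Reduce (H `\ h) S RG (S `\ h) h)
| Reduce_step (H S RG G : {fset D}) r r' of reduction_step G r r' :
    step (Reduce H S RG G r) (Reduce H S RG G r')
| Reduce_end (H S RG G : {fset D}) r of ~ reducible G r :
    step (Reduce H S RG G r) (Collect H S (if r != 0 then r |` RG else RG))
| Collect_end (S RG : {fset D}) : step (Collect fset0 S RG) (Return RG).

Definition start (S : {fset D}) : state := Prune S S.

Definition terminates (t : state) : Prop := Acc (fun t2 t1 => step t1 t2) t.

Definition reachable (t t' : state) : Prop := clos_refl_trans state step t t'.

End Dialgebra.

(* Main.v *)
Require Import Defs.
From mathcomp Require Import all_boot all_order all_algebra finmap.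
From mathcomp Require Import multinomials.monalg.
From Stdlib Require Import Classical.

Set Implicit Arguments.
Unset Strict Implicit.
Unset Printing Implicit Defensive.

Import GRing.Theory.
Local Open Scope fset_scope.
Local Open Scope ring_scope.

(** The proof compares everything with the leading monomials of the ideal
    [I = Id S].  A monic subset [B] of [I] is called here a [leading_basis] of [I] if
    the leading monomial of every nonzero member of [I] is the leading monomial of a
    normal [B]-polynomial.  Leading bases of [I] and Groebner--Shirshov bases for [I]
    are the same thing.

    One half of this is the composition-diamond lemma.  If the compositions of [S] are
    trivial, then multiplying a normal polynomial by a word yields a combination of
    normal polynomials whose words do not exceed the expected one
    ([normal_dashv_nspan], [normal_vdash_nspan]); so the normal polynomials span [I].
    Two normal polynomials with the same leading monomial differ by a combination of
    smaller ones ([common_lm_nspan]): the relation between their words is a multiple of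
    the one given by the least common multiple, where either a composition applies or
    the leading words are coprime and commutativity applies.  Hence, in a combination
    of normal polynomials, leading terms that cancel can be removed, and the leading
    monomial of a nonzero member of [I] is that of a normal polynomial
    ([composition_diamond]).  For the other half, a composition lies in [I], and
    dividing it by the members of a leading basis writes it as a trivial one
    ([leading_basis_GSB]).

    The delicate point is strongness. A polynomial which is not strong contains both
    basis elements of its leading word, and it covers (as leading monomials of its
    normal polynomials) far fewer monomials than a strong one with the same leading
    monomial. But if two members of [I] agree in their leading monomial and only one
    is strong, then their difference has the lower basis element of the leading word
    as leading monomial, so a third member of the basis covers this element
    ([strong_mismatch_cover]), and that member is strong and covers the multiples of
    the word. This settles the three places where the distinction matters: a
    polynomial dropped by the first loop was redundant ([prune_leading_basis]), the
    remainders computed by the second loop form a reduced basis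
    ([remainders_reduced]), and two reduced bases have the same leading monomials,
    hence coincide ([reduced_unique]).

    The algorithm terminates because both loops shrink a finite set and because
    one-step-reductions are well founded for a well ordering ([reduction_wf]).  Its
    result is obtained by following [invariant] along the transitions. *)

(** * Commutative words and basis elements *)

Section WordFacts.
Variable X : choiceType.
Implicit Types (u v w : word X) (m n : {cmonom X}) (a b c : basis X).

Lemma mmulI m : injective (mmul m).
Proof.
move=> n n' /eqP/cmP h; apply/eqP/cmP => i.
by have := h i; rewrite !cmM => /addnI.
Qed.

Lemma exists_lcm m n : exists w : {cmonom X}, is_lcm m n w.
Proof.
pose w : {cmonom X} :=
  [cmonom maxn (m i) (n i) | i in finsupp m `|` finsupp n]%M.
have wE i : w i = maxn (m i) (n i).
  by rewrite cmE fsfun_fun in_fsetE; case: (finsuppP m); case: (finsuppP n).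
have divE m1 m2 : (forall i, m1 i <= m2 i)%N -> divides m1 m2.
  move=> h; exists (divcm m2 m1); apply/eqP/cmP => i.
  by rewrite cmM divcmE subnKC.
have leE m1 m2 i : divides m1 m2 -> (m1 i <= m2 i)%N.
  by move=> [c ->]; rewrite cmM leq_addr.
exists w; split=> [||w' /leE h1 /leE h2]; apply: divE => i; rewrite wE.
- exact: leq_maxl.
- exact: leq_maxr.
by rewrite geq_max h1 h2.
Qed.

(** The cofactors [a0], [b0] of the least common multiple generate all relations
    [m * a = n * b], which reduces ambiguities to the minimal ones; the minimal relation
    either is an honest overlap or expresses commutativity. *)
Lemma lcm_cofactors m n : exists w a0 b0 : {cmonom X},
  [/\ is_lcm m n w, w = mmul m a0, w = mmul n b0,
      forall a b : {cmonom X}, mmul m a = mmul n b ->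
        exists c : {cmonom X}, a = mmul a0 c /\ b = mmul b0 c
    & (mdeg w < mdeg m + mdeg n)%N \/ a0 = n /\ b0 = m].
Proof.
have [w lw] := exists_lcm m n; have [[a0 wa] [b0 wb] wmin] := lw.
have key (a b : {cmonom X}) : mmul m a = mmul n b ->
    exists c : {cmonom X}, a = mmul a0 c /\ b = mmul b0 c.
  move=> e; have [||c ec] := wmin (mmul m a); [by exists a|by exists b|].
  exists c; split; first by apply: (@mmulI m); rewrite ec {1}wa mulmA.
  by apply: (@mmulI n); rewrite -e ec {1}wb mulmA.
exists w, a0, b0; split=> //.
have [c [en em]] := key n m (mulmC _ _).
have [c1|c1] := eqVneq c mone; first by right; rewrite en em c1 !mulm1.
left; rewrite -mdegM en mulmA -wa mdegM -[X in (X < _)%N]addn0 ltn_add2l.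
by rewrite lt0n mdeg_eq0.
Qed.

Lemma mmul_gen_split m : m != mone -> exists x (n : {cmonom X}), m = mmul (ucm x) n.
Proof.
have [e|[x xm]] := fset_0Vmem (finsupp m).
  by case/negP; apply/eqP/mdeg_eq0I; rewrite mdegE e big_seq_fset0.
move=> _; exists x, (divcm m (ucm x)); apply/eqP/cmP => i.
rewrite cmM divcmE subnKC // cmU.
by case: eqVneq => //= <-; rewrite lt0n cmE_neq0.
Qed.

Lemma word_gen_split w : exists x, w = word_gen x \/
  exists v, w = word_mul (word_gen x) v /\ (mdeg v < mdeg w)%N.
Proof.
case: w => m m0; have : m != mone by rewrite -mdeg_eq0 -lt0n.
move=> /mmul_gen_split[x [n e]]; exists x.
have [n0|n0] := posnP (mdeg n).
  by left; apply: val_inj; rewrite /= e (mdeg_eq0I n0) mulm1.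
right; exists (Word n0); split; first exact: val_inj.
by rewrite /= e mdegM mdegU.
Qed.

Lemma mdeg1_gen w : mdeg w = 1%N -> exists x, w = word_gen x.
Proof.
move=> w1; have [x [->|[v [e]]]] := word_gen_split w; first by exists x.
by rewrite w1 ltnS leqNgt; case: v {e} => ? /= ->.
Qed.

Lemma word_mulC : commutative (@word_mul X).
Proof. by move=> u v; apply: val_inj; apply: mulmC. Qed.

Lemma word_mulA : associative (@word_mul X).
Proof. by move=> u v w; apply: val_inj; apply: mulmA. Qed.

Lemma mdeg_gt0 u : (0 < mdeg u)%N.
Proof. by case: u. Qed.

Lemma mdeg_word_mul u v : mdeg (word_mul u v) = (mdeg u + mdeg v)%N.
Proof. exact: mdegM. Qed.

Lemma bindexP a : (bindex a = 1 /\ a = inl (bword a))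
  \/ (bindex a = 2 /\ mdeg (bword a) = 2)%N.
Proof. by case: a => [u|v]; [left|right; split=> //; apply/eqP; exact: (valP v)]. Qed.

Lemma basis_eq a b : bword a = bword b -> bindex a = bindex b -> a = b.
Proof.
case: a b => [u|v] [u'|v'] //= e _; first by rewrite e.
by congr inr; apply: val_inj; case: e.
Qed.

Lemma bword_vdash a b : bword (bvdash a b) = word_mul (bword a) (bword b).
Proof.
rewrite /bvdash; case: insubP => //= v _ e.
exact: val_inj.
Qed.

Lemma bindex_vdash a b :
  bindex (bvdash a b) =
  if mdeg (word_mul (bword a) (bword b)) == 2%N then 2%N else 1%N.
Proof.
rewrite /bvdash; case: insubP => [v -> //|].
by move=> /negbTE ->.
Qed.

(** Index 2 only occurs in length 2, hence only in products of two generators. *)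
Lemma bvdash_bdashv a b :
  (2 < mdeg (word_mul (bword a) (bword b)))%N -> bvdash a b = bdashv a b.
Proof.
move=> h; apply: basis_eq; first by rewrite bword_vdash.
by rewrite bindex_vdash; case: eqP h => [->|].
Qed.

Lemma bdashvC : commutative (@bdashv X).
Proof. by move=> a b; rewrite /bdashv word_mulC. Qed.

Lemma bvdashC : commutative (@bvdash X).
Proof. by move=> a b; rewrite /bvdash word_mulC. Qed.

End WordFacts.

(** * Monomial-center orderings *)

Section OrderFacts.
Variables (X : choiceType) (lt : rel (word X)).
Hypothesis Hlt : monomial_order lt.
Implicit Types (u v w : word X) (a b c : basis X).
Local Notation blt := (basis_lt lt).

Lemma wlt_irr u : lt u u = false. Proof. exact: mo_irr Hlt u. Qed.

Lemma wlt_trans v u w : lt u v -> lt v w -> lt u w.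
Proof. exact: (mo_trans Hlt). Qed.

Lemma wlt_mul2r u v w : lt (word_mul u w) (word_mul v w) = lt u v.
Proof.
apply/idP/idP; last by move=> h; apply: (mo_mul Hlt).
have [->|/(mo_total Hlt)/orP[//|h]] := eqVneq u v; first by rewrite wlt_irr.
by move=> /(wlt_trans (mo_mul Hlt _ h)); rewrite wlt_irr.
Qed.

Lemma wlt_mul2l u v w : lt (word_mul w u) (word_mul w v) = lt u v.
Proof. by rewrite !(word_mulC w) wlt_mul2r. Qed.

(** A product is larger than its factors: otherwise [u > uw > uww > ...]
    would descend for ever. *)
Lemma wlt_mulr u w : lt u (word_mul u w).
Proof.
elim/(well_founded_ind (mo_wf Hlt)): u => u IH.
have ne : u != word_mul u w.
  apply/eqP => /(congr1 (fun v : word X => mdeg v)); rewrite mdeg_word_mul => e.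
  by have := mdeg_gt0 w; rewrite -[X in (X < _)%N](subnn (mdeg u)) {1}e addKn ltnn.
case/orP: (mo_total Hlt ne) => // h.
by have := IH _ h; rewrite wlt_mul2r.
Qed.

Lemma blt_irr a : blt a a = false.
Proof. by rewrite /basis_lt wlt_irr ltnn andbF. Qed.

Lemma blt_trans b a c : blt a b -> blt b c -> blt a c.
Proof.
rewrite /basis_lt => /orP[h1|/andP[/eqP-> h1]] /orP[h2|/andP[/eqP<- h2]].
- by rewrite (wlt_trans h1 h2).
- by rewrite h1.
- by rewrite h2.
- by rewrite eqxx (ltn_trans h1 h2) orbT.
Qed.

Lemma blt_total a b : a != b -> blt a b || blt b a.
Proof.
move=> ne; rewrite /basis_lt (eq_sym (bword b)).
case: (eqVneq (bword a) (bword b)) => [e|/(mo_total Hlt)/orP[]->]; rewrite ?orbT //=.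
rewrite e wlt_irr /=; case: ltngtP => // ei.
by case/eqP: ne; apply: basis_eq.
Qed.

(** A word carries at most two basis elements, so a descent in [blt] can keep the
    word only once before it decreases. *)
Lemma blt_wf : well_founded blt.
Proof.
move=> a; move: {2}(bword a) (erefl (bword a)) => u.
elim/(well_founded_ind (mo_wf Hlt)): u a => u IH a ea.
suff low b : bword b = u -> bindex b = 1%N -> Acc blt b.
  case: (bindexP a) => -[ia _]; first exact: low.
  constructor=> b /orP[|/andP[/eqP eb]]; first by rewrite ea => /IH; apply.
  rewrite ia => ib; apply: low; first by rewrite eb.
  by case: (bindexP b) ib => -[-> _].
move=> eb ib; constructor=> c /orP[|/andP[_]]; first by rewrite eb => /IH; apply.
by rewrite ib => ic; case: (bindexP c) ic => -[-> _].
Qed.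

Lemma blt_word a b : lt (bword a) (bword b) -> blt a b.
Proof. by rewrite /basis_lt => ->. Qed.

Definition ble a b := (a == b) || blt a b.

Lemma ble_refl a : ble a a. Proof. by rewrite /ble eqxx. Qed.

Lemma bltNge a b : blt a b = ~~ ble b a.
Proof.
rewrite /ble; case: (eqVneq b a) => [->|ne] /=; first by rewrite blt_irr.
case h: (blt a b); last by have := blt_total ne; rewrite h orbF => ->.
by apply/esym/negP => /(blt_trans h); rewrite blt_irr.
Qed.

Lemma ble_lt_trans b a c : ble a b -> blt b c -> blt a c.
Proof. by case/orP=> [/eqP->//|]; apply: blt_trans. Qed.

Lemma ble_trans b a c : ble a b -> ble b c -> ble a c.
Proof. by move=> h /orP[/eqP<-//|h']; rewrite /ble (ble_lt_trans h h') orbT. Qed.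

Lemma ble_neq_lt a b : ble a b -> a != b -> blt a b.
Proof. by rewrite /ble => /predU1P[->|//]; rewrite eqxx. Qed.

Definition wle u v := (u == v) || lt u v.

Lemma wle_lt_trans v u w : wle u v -> lt v w -> lt u w.
Proof. by case/orP=> [/eqP->//|]; apply: wlt_trans. Qed.

Lemma wle_trans v u w : wle u v -> wle v w -> wle u w.
Proof. by move=> h /orP[/eqP<-//|h']; rewrite /wle (wle_lt_trans h h') orbT. Qed.

Lemma wle_mul2r u v w : wle u v -> wle (word_mul u w) (word_mul v w).
Proof. by case/orP=> [/eqP->|]; rewrite /wle ?eqxx // wlt_mul2r => ->; rewrite orbT. Qed.

Lemma ble_word a b : ble a b -> wle (bword a) (bword b).
Proof.
rewrite /wle; case/orP=> [/eqP->|/orP[->|/andP[-> _]]] //; rewrite ?eqxx ?orbT //.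
Qed.

Lemma blt_ble_index1 a b : blt b a -> ble b (inl (bword a)).
Proof.
rewrite /ble; case/orP=> [h|/andP[/eqP e ib]].
  by rewrite [X in _ || X](_ : _ = true) ?orbT //; apply: blt_word.
rewrite (_ : b = inl (bword a)) ?eqxx //; apply: basis_eq => //=.
case: (bindexP b) => [[//]|[b2 _]]; move: ib; rewrite b2.
by case: (bindexP a) => -[-> _].
Qed.

End OrderFacts.

(** * Bilinear products on the free dialgebra *)

Section Support.
Variables (k : fieldType) (X : choiceType).
Local Notation D := (Di k X).
Implicit Types (c : k) (f g h p q r : D) (P Q R : basis X -> Prop) (a b : basis X).

Definition supported P f : Prop := forall a, a \in msupp f -> P a.

Lemma supported0 P : supported P 0.
Proof. by move=> a; rewrite msupp0. Qed.

Lemma supportedD P f g : supported P f -> supported P g -> supported P (f + g).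
Proof.
move=> hf hg a /(fsubsetP (msuppD_le f g)).
by rewrite in_fsetU => /orP[/hf|/hg].
Qed.

Lemma supportedZ P (c : k) f : supported P f -> supported P (c *: f).
Proof. by move=> hf a /(fsubsetP (msuppZ_le c f)) /hf. Qed.

Lemma supportedN P f : supported P f -> supported P (- f).
Proof. by move=> hf a; rewrite msuppN => /hf. Qed.

Lemma supportedB P f g : supported P f -> supported P g -> supported P (f - g).
Proof. by move=> hf hg; apply: supportedD => //; apply: supportedN. Qed.

Lemma supportedU P (c : k) a : P a -> supported P << c *g a >>.
Proof. by move=> Pa b /(fsubsetP msuppU_le); rewrite in_fset1 => /eqP->. Qed.

Lemma supported_sum P (I : eqType) (s : seq I) (F : I -> D) :
  (forall i, i \in s -> supported P (F i)) -> supported P (\sum_(i <- s) F i).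
Proof.
move=> h; rewrite big_seq; elim/big_ind: _ => //; first exact: supported0.
by move=> x y; apply: supportedD.
Qed.

Lemma supportedW P Q f : (forall a, P a -> Q a) -> supported P f -> supported Q f.
Proof. by move=> PQ hf a /hf/PQ. Qed.

Section Bilin.
Variable op : basis X -> basis X -> basis X.

Lemma bilinEw (d e : {fset basis X}) f g :
  msupp f `<=` d -> msupp g `<=` e ->
  bilin op f g = \sum_(a <- d) \sum_(b <- e) << f@_a * g@_b *g op a b >>.
Proof.
move=> fd ge; rewrite /bilin (big_fset_incl _ fd) /=; last first.
  move=> a _ /mcoeff_outdom ->; rewrite big1 // => b _.
  by rewrite mul0r monalgU0.
apply: eq_bigr => a _; apply: (big_fset_incl _ ge) => b _ /mcoeff_outdom ->.
by rewrite mulr0 monalgU0.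
Qed.

Lemma bilinDl f f' g : bilin op (f + f') g = bilin op f g + bilin op f' g.
Proof.
rewrite (bilinEw (msuppD_le f f') (fsubset_refl (msupp g))).
rewrite (bilinEw (fsubsetUl (msupp f) (msupp f')) (fsubset_refl (msupp g))).
rewrite (bilinEw (fsubsetUr (msupp f) (msupp f')) (fsubset_refl (msupp g))).
rewrite -big_split /=; apply: eq_bigr => a _.
rewrite -big_split /=; apply: eq_bigr => b _.
by rewrite mcoeffD mulrDl monalgUD.
Qed.

Lemma bilinDr f g g' : bilin op f (g + g') = bilin op f g + bilin op f g'.
Proof.
rewrite (bilinEw (fsubset_refl (msupp f)) (msuppD_le g g')).
rewrite (bilinEw (fsubset_refl (msupp f)) (fsubsetUl (msupp g) (msupp g'))).
rewrite (bilinEw (fsubset_refl (msupp f)) (fsubsetUr (msupp g) (msupp g'))).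
rewrite -big_split /=; apply: eq_bigr => a _.
rewrite -big_split /=; apply: eq_bigr => b _.
by rewrite mcoeffD mulrDr monalgUD.
Qed.

Lemma scale_malgU (c d : k) a : c *: << d *g a >> = << c * d *g a >> :> D.
Proof. by apply/malgP => b; rewrite mcoeffZ !mcoeffU mulrnAr. Qed.

Lemma bilinZl (c : k) f g : bilin op (c *: f) g = c *: bilin op f g.
Proof.
rewrite (bilinEw (msuppZ_le c f) (fsubset_refl (msupp g))) /bilin.
rewrite scaler_sumr; apply: eq_bigr => a _.
rewrite scaler_sumr; apply: eq_bigr => b _.
by rewrite mcoeffZ scale_malgU mulrA.
Qed.

Lemma bilinZr (c : k) f g : bilin op f (c *: g) = c *: bilin op f g.
Proof.
rewrite (bilinEw (fsubset_refl (msupp f)) (msuppZ_le c g)) /bilin.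
rewrite scaler_sumr; apply: eq_bigr => a _.
rewrite scaler_sumr; apply: eq_bigr => b _.
by rewrite mcoeffZ scale_malgU mulrCA.
Qed.

Lemma bilinBl f f' g : bilin op (f - f') g = bilin op f g - bilin op f' g.
Proof. by rewrite bilinDl -[- f']scaleN1r bilinZl scaleN1r. Qed.

Lemma bilinBr f g g' : bilin op f (g - g') = bilin op f g - bilin op f g'.
Proof. by rewrite bilinDr -[- g']scaleN1r bilinZr scaleN1r. Qed.

Lemma bilinUU (c d : k) a b :
  bilin op << c *g a >> << d *g b >> = << c * d *g op a b >>.
Proof.
rewrite (bilinEw msuppU_le msuppU_le) !big_seq_fset1.
by rewrite !mcoeffUU.
Qed.

Lemma supported_bilin P Q R f g :
  (forall a b, P a -> Q b -> R (op a b)) ->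
  supported P f -> supported Q g -> supported R (bilin op f g).
Proof.
move=> h Pf Qg; apply: supported_sum => a /Pf Pa.
by apply: supported_sum => b /Qg Qb; apply: supportedU; apply: h.
Qed.

End Bilin.

Lemma linear_ext P (F G : D -> D) f :
  (forall g h, F (g + h) = F g + F h) -> (forall c g, F (c *: g) = c *: F g) ->
  (forall g h, G (g + h) = G g + G h) -> (forall c g, G (c *: g) = c *: G g) ->
  supported P f -> (forall a, P a -> F << a >> = G << a >>) -> F f = G f.
Proof.
move=> FD FZ GD GZ Pf FG; rewrite (monalgE f) big_seq.
elim/big_rec: _ => [|a h /Pf/FG Fa IH].
  by rewrite -(scale0r 0) FZ GZ !scale0r.
have -> : << f@_a *g a >> = f@_a *: << a >> :> D by rewrite scale_malgU mulr1.
by rewrite FD GD FZ GZ Fa IH.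
Qed.

Lemma eq_bilin_supp P Q op op' f g :
  supported P f -> supported Q g ->
  (forall a b, P a -> Q b -> op a b = op' a b) -> bilin op f g = bilin op' f g.
Proof.
move=> Pf Qg h; rewrite /bilin !big_seq; apply: eq_bigr => a /Pf Pa.
by rewrite !big_seq; apply: eq_bigr => b /Qg Qb; rewrite h.
Qed.

Lemma bilinC op f g : commutative op -> bilin op f g = bilin op g f.
Proof.
move=> opC; rewrite /bilin exchange_big; apply: eq_bigr => b _ /=.
by apply: eq_bigr => a _; rewrite mulrC opC.
Qed.

Lemma dashvC : commutative (@dashv k X).
Proof. by move=> f g; apply: bilinC; apply: bdashvC. Qed.

Lemma vdashC : commutative (@vdash k X).
Proof. by move=> f g; apply: bilinC; apply: bvdashC. Qed.

Lemma vdash_dashv f g :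
  supported (fun a => 1 < mdeg (bword a))%N f -> vdash f g = dashv f g.
Proof.
move=> hf; have gT : supported (fun _ => True) g by [].
apply: (eq_bilin_supp hf gT) => a b ha _; apply: bvdash_bdashv.
by rewrite mdeg_word_mul -addn1 leq_add ?mdeg_gt0.
Qed.

Lemma dashv_U1 f (u : word X) a : bword a = u -> dashv f << a >> = dashv f (word1 k u).
Proof.
move=> au; have fT : supported (fun _ => True) f by [].
apply: (linear_ext (F := fun g => dashv g << a >>)
  (G := fun g => dashv g (word1 k u)) _ _ _ _ fT).
- by move=> g h; apply: bilinDl.
- by move=> c g; apply: bilinZl.
- by move=> g h; apply: bilinDl.
- by move=> c g; apply: bilinZl.
by move=> b _; rewrite /dashv !bilinUU /bdashv au.
Qed.

Lemma dashv_word1A op f b (u v : word X) :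
  (forall a a', bword (op a a') = word_mul (bword a) (bword a')) -> bword b = u ->
  dashv (bilin op f << b >>) (word1 k v) = dashv f (word1 k (word_mul u v)).
Proof.
move=> opw bu; have fT : supported (fun _ => True) f by [].
apply: (linear_ext (F := fun g => dashv (bilin op g << b >>) (word1 k v))
  (G := fun g => dashv g (word1 k (word_mul u v))) _ _ _ _ fT).
- by move=> g h; rewrite /dashv !bilinDl.
- by move=> c g; rewrite /dashv !bilinZl.
- by move=> g h; apply: bilinDl.
- by move=> c g; apply: bilinZl.
move=> a _; rewrite /dashv !bilinUU /bdashv /= opw bu word_mulA.
by rewrite !mulr1.
Qed.

Lemma dashvA1 f (u v : word X) :
  dashv (dashv f (word1 k u)) (word1 k v) = dashv f (word1 k (word_mul u v)).
Proof. exact: dashv_word1A. Qed.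

Lemma vdash_dashvA1 f x (v : word X) :
  dashv (vdash f (gen k x)) (word1 k v) = dashv f (word1 k (word_mul (word_gen x) v)).
Proof. by apply: dashv_word1A => // a c; apply: bword_vdash. Qed.

Lemma supported_dashv1 P Q f (u : word X) :
  (forall a, P a -> Q (bdashv a (inl u))) -> supported P f ->
  supported Q (dashv f (word1 k u)).
Proof.
move=> h hf; apply: (supported_bilin (P := P) (Q := eq (inl u)) _ hf).
  by move=> a _ Pa <-; apply: h.
exact: supportedU.
Qed.

Lemma supported_vdash1 P Q f x :
  (forall a, P a -> Q (bvdash a (inl (word_gen x)))) -> supported P f ->
  supported Q (vdash f (gen k x)).
Proof.
move=> h hf; apply: (supported_bilin (P := P) (Q := eq (inl (word_gen x))) _ hf).
  by move=> a _ Pa <-; apply: h.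
exact: supportedU.
Qed.

Lemma vdash_dashv2 f (u : word X) x :
  vdash (dashv f (word1 k u)) (gen k x) = dashv f (word1 k (word_mul u (word_gen x))).
Proof.
rewrite vdash_dashv ?dashvA1 //.
apply: (supported_dashv1 (P := fun _ => True)) => // a _.
by rewrite /= mdegM (leq_add (mdeg_gt0 _) (mdeg_gt0 _)).
Qed.

Lemma vdashA2 f x y : vdash (vdash f (gen k x)) (gen k y)
  = dashv f (word1 k (word_mul (word_gen x) (word_gen y))).
Proof.
rewrite vdash_dashv ?vdash_dashvA1 //.
apply: (supported_vdash1 (P := fun _ => True)) => // a _.
by rewrite bword_vdash mdegM (leq_add (mdeg_gt0 _) (mdeg_gt0 _)).
Qed.

End Support.

(** * Leading monomials *)

Section Leading.
Variables (k : fieldType) (X : choiceType) (lt : rel (word X)).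
Hypothesis Hlt : monomial_order lt.
Local Notation D := (Di k X).
Local Notation blt := (basis_lt lt).
Local Notation lm := (@lm k X lt).
Local Notation lc := (@lc k X lt).
Local Notation tail := (@tail k X lt).
Local Notation strong := (@strong k X lt).
Local Notation ldeg := (@ldeg k X lt).
Local Notation lindex := (@lindex k X lt).
Local Notation normal := (@normal k X lt).
Implicit Types (f g h p q r s : D) (a b c : basis X) (u v w : word X).

Definition below a f := supported (fun b => blt b a) f.
Definition below_eq a f := supported (fun b => ble lt b a) f.
Definition wbelow u f := supported (fun b => lt (bword b) u) f.
Definition wbelow_eq u f := supported (fun b => wle lt (bword b) u) f.

Lemma wbelow_below a f : wbelow (bword a) f -> below a f.
Proof. by apply: supportedW => b; apply: blt_word. Qed.

Lemma below_notin a f : below a f -> a \notin msupp f.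
Proof. by move=> h; apply/negP => /h; rewrite blt_irr. Qed.

Lemma lm_seq_spec (s : seq (basis X)) :
  match \big[(fun a b : option (basis X) => if opt_lt blt a b then b else a)/None]_(a <- s) Some a with
  | None => s = [::]
  | Some a => a \in s /\ forall b, b \in s -> ble lt b a
  end.
Proof.
elim: s => [|a s IH]; first by rewrite big_nil.
rewrite big_cons; move: IH; case: (\big[_/_]_(_ <- s) _) => [b [bs bmax]|->] /=.
  case: ifP => [ab|/negbT nab].
    split=> [|c]; first by rewrite inE bs orbT.
    by rewrite inE => /orP[/eqP->|/bmax//]; rewrite /ble ab orbT.
  split=> [|c]; first by rewrite inE eqxx.
  rewrite inE => /orP[/eqP->|/bmax cb]; first exact: ble_refl.
  by apply: (ble_trans Hlt cb); apply: contraNT nab; rewrite (bltNge Hlt).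
split=> [|c]; first by rewrite inE eqxx.
by rewrite inE => /eqP->; apply: ble_refl.
Qed.

Lemma lm_None f : lm f = None -> f = 0.
Proof.
move=> e; have := lm_seq_spec (msupp f); rewrite -/(Defs.lm lt f) e => s0.
by rewrite (monalgE f) s0 big_nil.
Qed.

Lemma lm_in f a : lm f = Some a -> a \in msupp f.
Proof. by move=> e; have := lm_seq_spec (msupp f); rewrite -/(Defs.lm lt f) e => -[]. Qed.

Lemma lm_max f a : lm f = Some a -> below_eq a f.
Proof. by move=> e; have := lm_seq_spec (msupp f); rewrite -/(Defs.lm lt f) e => -[]. Qed.

Lemma lm_eq f a : a \in msupp f -> below_eq a f -> lm f = Some a.
Proof.
move=> af fa; case e: (lm f) => [b|]; last by move: af; rewrite (lm_None e) msupp0.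
have ab := lm_max e af; have /orP[/eqP->//|ba] := fa _ (lm_in e).
by move: ba; rewrite (bltNge Hlt) ab.
Qed.

Lemma lm0 : lm 0 = None.
Proof. by case e: (lm 0) => [a|//]; have := lm_in e; rewrite msupp0. Qed.

Lemma lm_exists f : f != 0 -> exists a, lm f = Some a.
Proof.
case e: (lm f) => [a|]; first by exists a.
by rewrite (lm_None e) eqxx.
Qed.

Lemma lm_neq0 f a : lm f = Some a -> f != 0.
Proof. by move=> e; apply: contraTneq (lm_in e) => ->; rewrite msupp0. Qed.

Lemma lcE f a : lm f = Some a -> lc f = f@_a.
Proof. by rewrite /Defs.lc => ->. Qed.

Lemma lc_neq0 f a : lm f = Some a -> lc f != 0.
Proof. by move=> e; rewrite (lcE e) mcoeff_neq0 (lm_in e). Qed.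

Lemma lc_lm f : lc f != 0 -> exists a, lm f = Some a.
Proof. by rewrite /Defs.lc; case: (lm f) => [a|] /=; [exists a|rewrite eqxx]. Qed.

Lemma lmD (c : k) a r : c != 0 -> below a r ->
  lm (<< c *g a >> + r) = Some a /\ lc (<< c *g a >> + r) = c.
Proof.
move=> c0 ra; have fa : (<< c *g a >> + r)@_a = c.
  by rewrite mcoeffD mcoeffUU (mcoeff_outdom (below_notin ra)) addr0.
have e : lm (<< c *g a >> + r) = Some a.
  apply: lm_eq; first by rewrite -mcoeff_neq0 fa.
  apply: supportedD; first by apply: supportedU; apply: ble_refl.
  by apply: supportedW ra => b h; rewrite /ble h orbT.
by split=> //; rewrite (lcE e).
Qed.

Lemma tail_decomp f a : lm f = Some a -> f = << lc f *g a >> + tail f.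
Proof. by move=> e; rewrite /Defs.tail e /= addrC subrK. Qed.

Lemma mcoeff_tail f a b : lm f = Some a ->
  (tail f)@_b = if b == a then 0 else f@_b.
Proof.
move=> e; rewrite /Defs.tail e /= mcoeffB mcoeffU (lcE e) eq_sym.
by case: eqP => [->|] /=; rewrite ?mulr1n ?subrr ?mulr0n ?subr0.
Qed.

Lemma msupp_tail f a b : lm f = Some a -> (b \in msupp (tail f)) = (b != a) && (b \in msupp f).
Proof.
move=> e; rewrite -!mcoeff_neq0 (mcoeff_tail _ e).
by case: (b == a) => //=; rewrite eqxx.
Qed.

Lemma tail_below f a : lm f = Some a -> below a (tail f).
Proof.
move=> e b; rewrite (msupp_tail _ e) => /andP[ne /(lm_max e) ba].
exact: ble_neq_lt ba ne.
Qed.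

Lemma tailP f a (c : k) r : f = << c *g a >> + r -> c != 0 -> below a r ->
  [/\ lm f = Some a, lc f = c & tail f = r].
Proof.
move=> -> c0 ra; have [e l] := lmD c0 ra; split=> //.
by rewrite /Defs.tail e l /= [_ + r]addrC addrK.
Qed.

Lemma below_sub f g a : lm f = Some a -> lm g = Some a -> lc f = lc g ->
  below a (f - g).
Proof.
move=> ef eg l; rewrite (tail_decomp ef) (tail_decomp eg) l opprD addrACA subrr.
by rewrite add0r; apply: supportedB; apply: tail_below.
Qed.

Lemma below_cancel f p a : lm f = Some a -> lm p = Some a ->
  below a (f - (f@_a / lc p) *: p).
Proof.
move=> ef ep; set c := _ / _.
have cp : c *: p = << lc f *g a >> + c *: tail p.
  by rewrite {1}(tail_decomp ep) scalerDr scale_malgU /c divfK ?(lc_neq0 ep) // (lcE ef).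
rewrite cp {1}(tail_decomp ef) opprD addrACA subrr add0r.
by apply: supportedB; [|apply: supportedZ]; apply: tail_below.
Qed.

Lemma sub_below_lead f p a (c : k) : lm f = Some a -> below a p ->
  [/\ lm (f - c *: p) = Some a, lc (f - c *: p) = lc f
     & tail (f - c *: p) = tail f - c *: p].
Proof.
move=> ef pa; apply: tailP.
- by rewrite addrA -(tail_decomp ef).
- exact: lc_neq0 ef.
by apply: supportedB; [apply: tail_below|apply: supportedZ].
Qed.

Lemma supported_lm_le P p h :
  (forall a b, ble lt a b -> P b -> P a) ->
  lm_le lt (lm p) (lm h) -> supported P h -> supported P p.
Proof.
move=> Pdown; case eh: (lm h) => [a|]; case ep: (lm p) => [b|];
  rewrite /lm_le ?(inj_eq (@Some_inj _)) //=.
- move=> ba Ph c /(lm_max ep) cb; apply: Pdown (Ph _ (lm_in eh)).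
  exact: (ble_trans Hlt cb).
- by move=> _ _; rewrite (lm_None ep); apply: supported0.
- by move=> _ _; rewrite (lm_None ep); apply: supported0.
Qed.

Lemma ble_below_down a : forall b c, ble lt b c -> blt c a -> blt b a.
Proof. by move=> b c; apply: ble_lt_trans. Qed.

Lemma ble_wbelow_down u : forall b c, ble lt b c -> lt (bword c) u -> lt (bword b) u.
Proof. by move=> b c /(ble_word) bc; apply: (wle_lt_trans Hlt bc). Qed.

Lemma ble_wbelow_eq_down u :
  forall b c, ble lt b c -> wle lt (bword c) u -> wle lt (bword b) u.
Proof. by move=> b c /(ble_word) bc; apply: (wle_trans Hlt bc). Qed.

(** ** Strong polynomials *)

Lemma strong_tail f a : lm f = Some a -> strong f <-> wbelow (bword a) (tail f).
Proof.
move=> e; rewrite /Defs.strong (lm_neq0 e) /= /lword e /=.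
case et: (lm (tail f)) => [b|] /=; last first.
  by rewrite (lm_None et); split=> // _; apply: supported0.
split=> [ba c /(lm_max et)/(ble_word) cb|/(_ _ (lm_in et))//].
exact: (wle_lt_trans Hlt cb).
Qed.

(** Since a word carries at most two basis elements, failing to be strong means
    containing both of them for the leading word. *)
Lemma strong_index1 f a : lm f = Some a ->
  strong f <-> (inl (bword a) \in msupp f -> bindex a = 1%N).
Proof.
move=> e; rewrite (strong_tail e); split=> [h ia|h b].
  case: (bindexP a) => [[]//|[ia2 _]].
  have : inl (bword a) \in msupp (tail f).
    rewrite (msupp_tail _ e) ia andbT; apply/eqP => ea.
    by move: ia2; rewrite -ea.
  by move/h; rewrite /= (wlt_irr Hlt).
move=> bt; have := tail_below e bt; move: bt.
rewrite (msupp_tail _ e) => /andP[ne bf] /orP[//|/andP[/eqP eb ib]].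
have e1 : bindex b = 1%N.
  case: (bindexP b) => -[ib' _] //; move: ib; rewrite ib'.
  by case: (bindexP a) => -[-> _].
have ebl : inl (bword a) = b by apply: basis_eq.
by move: ib; rewrite e1 h // ebl.
Qed.

Lemma ldegE f a : lm f = Some a -> ldeg f = mdeg (bword a).
Proof. by rewrite /Defs.ldeg /lword => ->. Qed.

Lemma lindexE f a : lm f = Some a -> lindex f = bindex a.
Proof. by rewrite /Defs.lindex => ->. Qed.

Lemma index1_strong f a : lm f = Some a -> bindex a = 1%N -> strong f.
Proof. by move=> e ia; apply/(strong_index1 e). Qed.

Lemma ldeg1_strong f : ldeg f = 1%N -> strong f.
Proof.
rewrite /Defs.ldeg /lword; case e: (lm f) => [a|//] /= d1.
apply: (index1_strong e); case: (bindexP a) => [[]//|[_]].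
by rewrite d1.
Qed.

Lemma nonstrong_lm f : f != 0 -> ~~ strong f ->
  exists a, [/\ lm f = Some a, bindex a = 2%N, mdeg (bword a) = 2%N
              & inl (bword a) \in msupp f].
Proof.
move=> /lm_exists[a e] ns; exists a.
case: (bindexP a) => -[ia da]; first by rewrite (index1_strong e) in ns.
split=> //; apply: contraNT ns => h; apply/(strong_index1 e) => h'.
by rewrite h' in h.
Qed.

(** ** Leading monomials of normal polynomials *)

Lemma dashv_tail f a u : lm f = Some a ->
  dashv f (word1 k u) =
  << lc f *g inl (word_mul (bword a) u) >> + dashv (tail f) (word1 k u).
Proof. by move=> e; rewrite {1}(tail_decomp e) /dashv bilinDl /word1 bilinUU mulr1. Qed.

Lemma lm_dashv f a u : lm f = Some a -> strong f ->
  lm (dashv f (word1 k u)) = Some (bdashv a (inl u))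
  /\ lc (dashv f (word1 k u)) = lc f.
Proof.
move=> e sf; have [] := @tailP (dashv f (word1 k u)) (bdashv a (inl u)) (lc f)
  (dashv (tail f) (word1 k u)).
- exact: dashv_tail.
- exact: (lc_neq0 e).
- apply: (supported_dashv1 (P := fun b => lt (bword b) (bword a))).
    by move=> b h; apply: blt_word; rewrite /= wlt_mul2r.
  exact/(strong_tail e).
by move=> -> ->.
Qed.

Lemma lm_vdash f a x : lm f = Some a -> ldeg f = 1%N ->
  [/\ lm (vdash f (gen k x)) = Some (bvdash a (inl (word_gen x))),
      lc (vdash f (gen k x)) = lc f & strong (vdash f (gen k x))].
Proof.
move=> e d1; have tlt : wbelow (bword (bvdash a (inl (word_gen x))))
    (vdash (tail f) (gen k x)).
  apply: (supported_vdash1 (P := fun b => lt (bword b) (bword a))).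
    by move=> b h; rewrite !bword_vdash wlt_mul2r.
  exact/(strong_tail e)/ldeg1_strong.
have [] := @tailP (vdash f (gen k x)) (bvdash a (inl (word_gen x)))
  (lc f) (vdash (tail f) (gen k x)).
- by rewrite {1}(tail_decomp e) /vdash bilinDl /gen /word1 bilinUU mulr1.
- exact: (lc_neq0 e).
- exact: wbelow_below.
by move=> e' -> t'; split=> //; apply/(strong_tail e'); rewrite t'.
Qed.

Lemma normal_lm s (d : {cmonom X}) m p a : normal s d m p -> lm s = Some a ->
  exists b, [/\ lm p = Some b, word_val (bword b) = mmul (word_val (bword a)) d,
                bindex b = m & lc p = lc s].
Proof.
case=> [|x d1|u ss] e.
- by exists a; split=> //; [rewrite mulm1|rewrite (lindexE e)].
- have [l1 l2 _] := lm_vdash x e d1; exists (bvdash a (inl (word_gen x))).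
  split=> //; first by rewrite bword_vdash.
  by rewrite bindex_vdash /= mdegM mdegU -(ldegE e) d1.
have [l1 l2] := lm_dashv u e ss; exists (bdashv a (inl u)).
by split.
Qed.

Lemma normal_cases s (d : {cmonom X}) m p : normal s d m p ->
  [\/ [/\ d = mone, m = lindex s & p = s],
      exists x, [/\ d = ucm x, m = 2%N, ldeg s = 1%N & p = vdash s (gen k x)]
    | exists u : word X, [/\ d = u, m = 1%N, strong s & p = dashv s (word1 k u)]].
Proof.
by case=> [|x e|u e]; [apply: Or31|apply: Or32; exists x|apply: Or33; exists u].
Qed.

End Leading.

(** * Spans of normal polynomials *)

Section Span.
Variables (k : fieldType) (V : lmodType k).
Implicit Types (P Q : V -> Prop) (f g p : V).

Inductive span P : V -> Prop :=
| span0 : span P 0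
| span_step (c : k) p f of P p & span P f : span P (c *: p + f).

Lemma span_mem P p : P p -> span P p.
Proof.
by move=> Pp; rewrite -[p]addr0 -[p]scale1r; apply: span_step Pp (span0 P).
Qed.

Lemma spanD P f g : span P f -> span P g -> span P (f + g).
Proof.
move=> hf hg; elim: hf => [|c p f' Pp _ IH]; first by rewrite add0r.
by rewrite -addrA; apply: span_step.
Qed.

Lemma spanZ P (c : k) f : span P f -> span P (c *: f).
Proof.
elim=> [|d p f' Pp _ IH]; first by rewrite scaler0; apply: span0.
by rewrite scalerDr scalerA; apply: span_step.
Qed.

Lemma spanN P f : span P f -> span P (- f).
Proof. by rewrite -scaleN1r; apply: spanZ. Qed.

Lemma spanB P f g : span P f -> span P g -> span P (f - g).
Proof. by move=> hf hg; apply: spanD => //; apply: spanN. Qed.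

Lemma span_sum P (I : eqType) (s : seq I) (F : I -> V) :
  (forall i, i \in s -> span P (F i)) -> span P (\sum_(i <- s) F i).
Proof.
move=> h; rewrite big_seq; elim/big_ind: _ => //; first exact: span0.
by move=> x y; apply: spanD.
Qed.

Lemma span_linear P Q (F : V -> V) f :
  (forall g h, F (g + h) = F g + F h) -> (forall c g, F (c *: g) = c *: F g) ->
  (forall p, P p -> span Q (F p)) -> span P f -> span Q (F f).
Proof.
move=> FD FZ PQ; elim=> [|c p f' Pp _ IH].
  by rewrite -(scale0r 0) FZ scale0r; apply: span0.
by rewrite FD FZ; apply: spanD => //; apply: spanZ; apply: PQ.
Qed.

Lemma spanW P Q f : (forall p, P p -> Q p) -> span P f -> span Q f.
Proof. by move=> PQ; elim=> [|c p f' /PQ Qp _ IH]; [apply: span0|apply: span_step]. Qed.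

End Span.

Section Ideal.
Variables (k : fieldType) (X : choiceType) (lt : rel (word X)).
Hypothesis Hlt : monomial_order lt.
Local Notation D := (Di k X).
Local Notation lm := (@lm k X lt).
Local Notation normal := (@normal k X lt).
Implicit Types (f g h p q r s : D) (a b c : basis X) (u v w : word X) (S I : D -> Prop).

Local Opaque dashv vdash.

Lemma dashvDl f g h : dashv (f + g) h = dashv f h + dashv g h.
Proof. exact: bilinDl. Qed.
Lemma dashvBl f g h : dashv (f - g) h = dashv f h - dashv g h.
Proof. exact: bilinBl. Qed.
Lemma dashvZl (c : k) g h : dashv (c *: g) h = c *: dashv g h.
Proof. exact: bilinZl. Qed.
Lemma dashvDr f g h : dashv f (g + h) = dashv f g + dashv f h.
Proof. exact: bilinDr. Qed.
Lemma dashvZr (c : k) g h : dashv g (c *: h) = c *: dashv g h.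
Proof. exact: bilinZr. Qed.
Lemma vdashDl f g h : vdash (f + g) h = vdash f h + vdash g h.
Proof. exact: bilinDl. Qed.
Lemma vdashBl f g h : vdash (f - g) h = vdash f h - vdash g h.
Proof. exact: bilinBl. Qed.
Lemma vdashZl (c : k) g h : vdash (c *: g) h = c *: vdash g h.
Proof. exact: bilinZl. Qed.
Lemma vdashDr f g h : vdash f (g + h) = vdash f g + vdash f h.
Proof. exact: bilinDr. Qed.
Lemma vdashBr f g h : vdash f (g - h) = vdash f g - vdash f h.
Proof. exact: bilinBr. Qed.
Lemma vdashZr (c : k) g h : vdash g (c *: h) = c *: vdash g h.
Proof. exact: bilinZr. Qed.

Lemma mul_basis_mem (P : basis X -> Prop) I (F : D -> D) g :
  I 0 -> (forall f h, I f -> I h -> I (f + h)) -> (forall (c : k) f, I f -> I (c *: f)) ->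
  (forall f h, F (f + h) = F f + F h) -> (forall (c : k) f, F (c *: f) = c *: F f) ->
  supported P g -> (forall a, P a -> I (F << a >>)) -> I (F g).
Proof.
move=> I0 ID IZ FD FZ Pg IF; rewrite (monalgE g) big_seq.
elim/big_rec: _ => [|a h /Pg Pa IH]; first by rewrite -(scale0r 0) FZ scale0r.
have -> : << g@_a *g a >> = g@_a *: << a >> :> D by rewrite scale_malgU mulr1.
by rewrite FD FZ; apply: ID => //; apply: IZ; apply: IF.
Qed.

(** Both operations are commutative, they agree unless both factors are generators, and
    [dashv] only sees the word of its right factor; so it is enough to test right
    products by words for [dashv] and by generators for [vdash]. *)
Lemma ideal_intro I :
  I 0 -> (forall f g, I f -> I g -> I (f + g)) -> (forall (c : k) f, I f -> I (c *: f)) ->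
  (forall f u, I f -> I (dashv f (word1 k u))) ->
  (forall f x, I f -> I (vdash f (gen k x))) -> is_ideal I.
Proof.
move=> I0 ID IZ Id1 Iv1.
have Id f g : I f -> I (dashv f g).
  move=> If; apply: (mul_basis_mem (P := fun _ => True) (F := dashv f)) => //.
  - exact: dashvDr.
  - by move=> c h; apply: dashvZr.
  by move=> a _; rewrite (dashv_U1 f (erefl (bword a))); apply: Id1.
have Iv f g : I f -> I (vdash f g).
  move=> If; apply: (mul_basis_mem (P := fun _ => True) (F := vdash f)) => //.
  - exact: vdashDr.
  - by move=> c h; apply: vdashZr.
  move=> a _; case: (ltngtP (mdeg (bword a)) 1%N) => [|a2|/mdeg1_gen[x ax]].
  - by rewrite ltnNge mdeg_gt0.
  - rewrite vdashC vdash_dashv; last exact: supportedU.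
    by rewrite dashvC; apply: Id.
  suff -> : a = inl (word_gen x) by apply: Iv1.
  apply: basis_eq => //; case: (bindexP a) => -[] // _.
  by rewrite ax /= mdegU.
split=> // f g If; first by split; [|rewrite vdashC]; apply: Iv.
by split; [|rewrite dashvC]; apply: Id.
Qed.

Lemma ideal_normal I s (d : {cmonom X}) m p : is_ideal I -> I s -> normal s d m p -> I p.
Proof.
move=> II Is; case=> // [x _|u _]; first by case: (ideal_vdash II (gen k x) Is).
by case: (ideal_dashv II (word1 k u) Is).
Qed.

Lemma idealN I f : is_ideal I -> I f -> I (- f).
Proof. by move=> II If; rewrite -scaleN1r; apply: idealZ. Qed.

Lemma idealB I f g : is_ideal I -> I f -> I g -> I (f - g).
Proof. by move=> II If Ig; apply: idealD => //; apply: idealN. Qed.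

Lemma span_ideal I (P : D -> Prop) f : is_ideal I -> (forall p, P p -> I p) -> span P f -> I f.
Proof.
move=> II PI; elim=> [|c p f' /PI Ip _ IH]; first exact: ideal0.
by apply: idealD => //; apply: idealZ.
Qed.

Lemma Id_ideal S : is_ideal (Id S).
Proof.
split=> [I II _|f g hf hg I II SI|c f hf I II SI|f g hf|f g hf].
- exact: ideal0.
- by apply: idealD => //; [apply: hf|apply: hg].
- by apply: idealZ => //; apply: hf.
- by split=> I II SI; case: (ideal_vdash II g (hf I II SI)).
by split=> I II SI; case: (ideal_dashv II g (hf I II SI)).
Qed.

Lemma Id_mem S s : S s -> Id S s.
Proof. by move=> Ss I _; apply. Qed.

Lemma composition_ideal I f g h : is_ideal I -> I f -> I g ->
  composition lt f g h -> I h.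
Proof.
move=> II If Ig; have Iv x := (ideal_vdash II (gen k x) If).1.
have Id x := (ideal_dashv II (gen k x) If).1.
case=> [x _|x _|x y _ _ _|_ _|x m p _ _ np _|x p q _ _ _ _ _ np nq
       |u v w a b p q _ _ _ _ _ _ _ _ _ _ _ _ np nq];
  try by [|apply: idealB].
- by apply: idealB => //; apply: ideal_normal np.
- by apply: idealB => //; [apply: ideal_normal np|apply: ideal_normal nq].
by apply: idealB => //; [apply: ideal_normal np|apply: ideal_normal nq].
Qed.

(** The predicate [P] will be a bound on monomials or on words.  It bounds the whole
    support of each normal polynomial, not only its leading monomial, which makes it
    stable under the products below. *)
Definition nspan S (P : basis X -> Prop) : D -> Prop :=
  span (fun p => normal_in lt S p /\ supported P p).

Lemma nspanW S (P Q : basis X -> Prop) f :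
  (forall a, P a -> Q a) -> nspan S P f -> nspan S Q f.
Proof. by move=> PQ; apply: spanW => p [np Pp]; split=> //; apply: supportedW Pp. Qed.

(** Triviality bounds the summands by the leading monomial of [h], so it respects every
    bound on [h] that is closed downwards. *)
Lemma trivial_nspan S (P : basis X -> Prop) h :
  (forall a b, ble lt a b -> P b -> P a) -> trivial_mod lt S h -> supported P h ->
  nspan S P h.
Proof.
move=> Pdown [l [-> hl]] Ph; apply: span_sum => -[c p] /hl/= [np hp].
have [->|/hp lep] := eqVneq c 0; first by rewrite scale0r; apply: span0.
apply: spanZ; apply: span_mem; split=> //.
exact: (supported_lm_le Hlt Pdown lep).
Qed.

Lemma nspan_trivial S h :
  nspan S (fun a => lm_le lt (Some a) (lm h)) h -> trivial_mod lt S h.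
Proof.
rewrite /trivial_mod; move: (lm h) => o hh.
suff [l [e hl]] : exists l : seq (k * D), h = \sum_(i <- l) i.1 *: i.2 /\
    forall i, i \in l -> normal_in lt S i.2 /\ supported (fun a => lm_le lt (Some a) o) i.2.
  exists l; split=> // i /hl[ni si]; split=> // _.
  case e2: (lm i.2) => [a|]; first by apply: si; apply: lm_in e2.
  by case: (o).
elim: hh => [|c p f [np sp] _ [l [-> hl]]]; first by exists [::]; rewrite big_nil.
exists ((c, p) :: l); rewrite big_cons; split=> // i.
by rewrite inE => /predU1P[->|/hl].
Qed.

End Ideal.

(** * The composition-diamond lemma *)

Section CompositionDiamond.
Variables (k : fieldType) (X : choiceType) (lt : rel (word X)).
Hypothesis Hlt : monomial_order lt.
Local Notation D := (Di k X).
Local Notation blt := (basis_lt lt).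
Local Notation lm := (@lm k X lt).
Local Notation lc := (@lc k X lt).
Local Notation tail := (@tail k X lt).
Local Notation strong := (@strong k X lt).
Local Notation ldeg := (@ldeg k X lt).
Local Notation lindex := (@lindex k X lt).
Local Notation normal := (@normal k X lt).
Local Notation wbelow := (@wbelow k X lt).
Local Notation wbelow_eq := (@wbelow_eq k X lt).
Variable S : D -> Prop.
Hypothesis GS : GSB lt S.
Implicit Types (f g h p q r s : D) (a b c : basis X) (u v w : word X).
Local Notation nspan := (nspan lt S).
Local Notation normal_in := (normal_in lt S).
Local Notation nspan_lt u := (nspan (fun a => lt (bword a) u)).
Local Notation nspan_le u := (nspan (fun a => wle lt (bword a) u)).

Local Opaque dashv vdash basis_lt.

Lemma monic_lm s : S s -> exists a, lm s = Some a.
Proof. by move=> /(proj1 GS) l1; apply: lc_lm; rewrite l1 oner_neq0. Qed.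

Lemma normal_in_lm p : normal_in p -> exists a, lm p = Some a /\ lc p = 1.
Proof.
move=> [s [d [m [Ss np]]]]; have [a e] := monic_lm Ss.
have [b [eb _ _ l]] := normal_lm Hlt np e.
by exists b; rewrite l (proj1 GS).
Qed.

Lemma nspan_mem (P : basis X -> Prop) p : normal_in p -> supported P p -> nspan P p.
Proof. by move=> np Pp; apply: span_mem. Qed.

Lemma normal_in_self s : S s -> normal_in s.
Proof. by move=> Ss; exists s, mone, (lindex s); split=> //; apply: Normal_self. Qed.

Lemma normal_in_dashv s u : S s -> strong s -> normal_in (dashv s (word1 k u)).
Proof. by move=> Ss ss; exists s, (u : {cmonom X}), 1%N; split=> //; apply: Normal_dashv. Qed.

Lemma normal_in_vdash s x : S s -> ldeg s = 1%N -> normal_in (vdash s (gen k x)).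
Proof. by move=> Ss ss; exists s, (ucm x), 2%N; split=> //; apply: Normal_vdash. Qed.

Lemma composition_nspan (P : basis X -> Prop) f g h :
  (forall a b, ble lt a b -> P b -> P a) -> S f -> S g -> composition lt f g h ->
  supported P h -> nspan P h.
Proof. by move=> Pd Sf Sg /(proj2 GS _ _ _ Sf Sg); apply: trivial_nspan. Qed.

Lemma wbelow_eq_dashv p u v : wbelow_eq v p ->
  wbelow_eq (word_mul v u) (dashv p (word1 k u)).
Proof. by apply: supported_dashv1 => a; apply: wle_mul2r. Qed.

Lemma wbelow_eq_vdash p x v : wbelow_eq v p ->
  wbelow_eq (word_mul v (word_gen x)) (vdash p (gen k x)).
Proof. by apply: supported_vdash1 => a h; rewrite bword_vdash; apply: wle_mul2r. Qed.

Lemma nspan_le_dashv_of u v (f : D) :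
  (forall p, normal_in p -> wbelow_eq v p -> nspan_le (word_mul v u) (dashv p (word1 k u))) ->
  nspan_le v f -> nspan_le (word_mul v u) (dashv f (word1 k u)).
Proof.
move=> h; apply: (span_linear (F := fun f => dashv f _)).
- by move=> g g'; apply: dashvDl.
- by move=> c g; apply: dashvZl.
by move=> p [np hp]; apply: h.
Qed.

(** Products of normal polynomials by words are again combinations of normal
    polynomials, without increase of the leading word: a strong factor absorbs
    any word, and for the others the composition by one letter is trivial, after
    which the remaining letters are absorbed by induction on the length. *)
Lemma normal_dashv_nspan p u v : normal_in p -> wbelow_eq v p ->
  nspan_le (word_mul v u) (dashv p (word1 k u)).
Proof.
have [n] := ubnP (mdeg u); elim: n p u v => // n IH p u v un np hp.
have hd := wbelow_eq_dashv (u := u) hp.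
have [s [d [m [Ss]]]] := np => /normal_cases[[_ _ ep]|[x [_ _ d1 ep]]|[w [_ _ ss ep]]].
- have [ss|ns] := boolP (strong s).
    by apply: nspan_mem => //; rewrite ep; apply: normal_in_dashv.
  rewrite -ep in ns Ss; have comp x : nspan_le (word_mul v (word_gen x)) (dashv p (gen k x)).
    apply: (composition_nspan _ Ss Ss); first exact: ble_wbelow_eq_down.
      exact: Comp_nonstrong_dashv.
    exact: wbelow_eq_dashv.
  have [x [->//|[w [eu wu]]]] := word_gen_split u.
  rewrite eu -dashvA1 word_mulA; apply: nspan_le_dashv_of (comp x).
  by move=> q nq hq; apply: IH => //; apply: leq_trans wu _.
- apply: nspan_mem => //; rewrite ep vdash_dashvA1.
  exact/normal_in_dashv/ldeg1_strong.
by apply: nspan_mem => //; rewrite ep dashvA1; apply: normal_in_dashv.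
Qed.

(** The product of a strong [p] of higher degree by a generator differs from
    [dashv p x] only through the generators in the support of [p]; if there are any,
    the difference is a composition. *)
Lemma normal_vdash_nspan p x v : normal_in p -> wbelow_eq v p ->
  nspan_le (word_mul v (word_gen x)) (vdash p (gen k x)).
Proof.
move=> np hp; have hd := wbelow_eq_vdash (x := x) hp.
have [s [d [m [Ss]]]] := np => /normal_cases[[_ _ ep]|[y [_ _ d1 ep]]|[w [_ _ ss ep]]].
- rewrite -{}ep in Ss; have down := @ble_wbelow_eq_down _ _ Hlt (word_mul v (word_gen x)).
  have [ss|ns] := boolP (strong p); last first.
    by apply: (composition_nspan down Ss Ss) => //; apply: Comp_nonstrong_vdash.
  have [d1|d1] := eqVneq (ldeg p) 1%N.
    by apply: nspan_mem => //; apply: normal_in_vdash.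
  have d1' : (1 < ldeg p)%N.
    have [a e] := monic_lm Ss; move: d1; rewrite (ldegE e).
    by case: (ltngtP (mdeg (bword a)) 1%N) => //; rewrite ltnNge mdeg_gt0.
  have np' := nspan_mem (normal_in_dashv (word_gen x) Ss ss) (wbelow_eq_dashv (u := word_gen x) hp).
  have [[y yp]|noX] := classic (exists y, (inl (word_gen y) : basis X) \in msupp p).
    rewrite -[vdash _ _](subrK (dashv p (gen k x))); apply: spanD np'.
    apply: (composition_nspan down Ss Ss); first exact: Comp_linear d1' yp.
    by apply: supportedB => //; apply: wbelow_eq_dashv.
  rewrite vdash_dashv // => a ap; rewrite ltnNge; apply/negP => a1.
  case: noX; have /mdeg1_gen[y ay] : mdeg (bword a) = 1%N.
    by apply/eqP; rewrite eqn_leq a1 mdeg_gt0.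
  exists y; rewrite -ay; case: (bindexP a) => -[_] a2; first by rewrite -a2.
  by rewrite a2 in a1.
- apply: nspan_mem => //; rewrite ep vdashA2.
  exact/normal_in_dashv/ldeg1_strong.
by apply: nspan_mem => //; rewrite ep vdash_dashv2; apply: normal_in_dashv.
Qed.

(** Strict bounds follow from the previous estimates because multiplication by a word is
    strictly monotone; the estimate is applied with the leading word of each normal
    polynomial. *)
Lemma nspan_lt_lift (F : D -> D) u u' f :
  (forall g h, F (g + h) = F g + F h) -> (forall (c : k) g, F (c *: g) = c *: F g) ->
  (forall p v, normal_in p -> wbelow_eq v p -> nspan_le (word_mul v u') (F p)) ->
  nspan_lt u f -> nspan_lt (word_mul u u') (F f).
Proof.
move=> FD FZ hF; apply: span_linear => // p [np hp].
have [a [e _]] := normal_in_lm np.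
have /(hF _ _ np) : wbelow_eq (bword a) p.
  by move=> b /(lm_max Hlt e); apply: ble_word.
apply: nspanW => b hb; apply: (wle_lt_trans Hlt hb); rewrite wlt_mul2r //.
exact: hp (lm_in Hlt e).
Qed.

Lemma nspan_lt_dashv u v f : nspan_lt u f -> nspan_lt (word_mul u v) (dashv f (word1 k v)).
Proof.
apply: (nspan_lt_lift (F := fun f => dashv f _)) => [g h|c g|p w].
- exact: dashvDl.
- exact: dashvZl.
exact: normal_dashv_nspan.
Qed.

Lemma nspan_lt_vdash u x f :
  nspan_lt u f -> nspan_lt (word_mul u (word_gen x)) (vdash f (gen k x)).
Proof.
apply: (nspan_lt_lift (F := fun f => vdash f _)) => [g h|c g|p w].
- exact: vdashDl.
- exact: vdashZl.
exact: normal_vdash_nspan.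
Qed.

Lemma nspan_supported P f : nspan P f -> supported P f.
Proof.
elim=> [|c p f' [_ hp] _ IH]; first exact: supported0.
by apply: supportedD => //; apply: supportedZ.
Qed.

Lemma nspan_ideal : is_ideal (nspan (fun _ => True)).
Proof.
have bounded (F : D -> D) u f :
    (forall g h, F (g + h) = F g + F h) -> (forall (c : k) g, F (c *: g) = c *: F g) ->
    (forall p v, normal_in p -> wbelow_eq v p -> nspan_le (word_mul v u) (F p)) ->
    nspan (fun _ => True) f -> nspan (fun _ => True) (F f).
  move=> FD FZ hF; apply: span_linear => // p [np _].
  have [a [e _]] := normal_in_lm np.
  apply: nspanW (hF _ (bword a) np _) => //.
  by move=> b /(lm_max Hlt e); apply: ble_word.
apply: ideal_intro.
- exact: span0.
- by move=> f g; apply: spanD.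
- by move=> c f; apply: spanZ.
- move=> f u; apply: (bounded (fun f => dashv f _) u) => [g h|c g|p w].
  + exact: dashvDl.
  + exact: dashvZl.
  exact: normal_dashv_nspan.
move=> f x; apply: (bounded (fun f => vdash f _) (word_gen x)) => [g h|c g|p w].
- exact: vdashDl.
- exact: vdashZl.
exact: normal_vdash_nspan.
Qed.

Lemma Id_nspan f : Id S f -> nspan (fun _ => True) f.
Proof.
apply; first exact: nspan_ideal.
by move=> s Ss; apply: nspan_mem => //; apply: normal_in_self.
Qed.

(** ** Normal polynomials with a common leading monomial *)

(** Multiplication by a possibly empty word, so that the cofactors of a least common
    multiple can be used without separating the trivial ones. *)
Definition mulc p (d : {cmonom X}) : D :=
  if insub d is Some u then dashv p (word1 k u) else p.

Lemma mulcE p u : mulc p u = dashv p (word1 k u).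
Proof. by rewrite /mulc valK. Qed.

Lemma mulc1 p : mulc p mone = p.
Proof. by rewrite /mulc insubF // mdeg1. Qed.

Lemma cmonom_case (d : {cmonom X}) : d = mone \/ exists u : word X, d = u.
Proof.
have [e|] := eqVneq d mone; first by left.
by rewrite -mdeg_eq0 -lt0n => d0; right; exists (Word d0).
Qed.

Lemma mulcM p (d e : {cmonom X}) : mulc (mulc p d) e = mulc p (mmul d e).
Proof.
case: (cmonom_case d) => [->|[u ->]]; first by rewrite mulc1 mul1m.
case: (cmonom_case e) => [->|[v ->]]; first by rewrite mulc1 mulm1.
by rewrite -[mmul _ _]/(word_val (word_mul u v)) !mulcE dashvA1.
Qed.

Lemma mulcB p q (d : {cmonom X}) : mulc (p - q) d = mulc p d - mulc q d.
Proof.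
by case: (cmonom_case d) => [->|[u ->]]; rewrite ?mulc1 // !mulcE dashvBl.
Qed.

Lemma mulc_sub f g u v (d e c : {cmonom X}) :
  word_val u = mmul d c -> word_val v = mmul e c ->
  dashv f (word1 k u) - dashv g (word1 k v) = mulc (mulc f d - mulc g e) c.
Proof. by move=> uc vc; rewrite mulcB !mulcM -uc -vc !mulcE. Qed.

Lemma nspan_lt_mulc u v (d : {cmonom X}) f : word_val v = mmul (u : {cmonom X}) d ->
  nspan_lt u f -> nspan_lt v (mulc f d).
Proof.
case: (cmonom_case d) => [->|[w ->]].
  by rewrite mulm1 mulc1 => /val_inj ->.
move=> e hf; rewrite mulcE; have -> : v = word_mul u w by apply: val_inj.
exact: nspan_lt_dashv.
Qed.

Lemma normal_strong s (d : {cmonom X}) m p : S s -> normal s d m p -> strong s -> strong p.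
Proof.
move=> /monic_lm[a e]; case=> // [x d1|u _] ss.
  by have [] := lm_vdash Hlt x e d1.
by apply: (index1_strong Hlt (lm_dashv Hlt u e ss).1).
Qed.

Lemma strong_sub f g a : lm f = Some a -> lm g = Some a -> lc f = lc g ->
  strong f -> strong g -> wbelow (bword a) (f - g).
Proof.
move=> ef eg l /(strong_tail Hlt ef) sf /(strong_tail Hlt eg) sg.
rewrite (tail_decomp ef) (tail_decomp eg) l opprD addrACA subrr add0r.
exact: (supportedB sf sg).
Qed.

Lemma composition_nspan_lt f g h u : S f -> S g -> composition lt f g h ->
  wbelow u h -> nspan_lt u h.
Proof. by move=> Sf Sg; apply: composition_nspan => //; apply: ble_wbelow_down. Qed.

Lemma normal_mulc s (d : {cmonom X}) : strong s -> (d = mone -> lindex s = 1%N) ->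
  normal s d 1 (mulc s d).
Proof.
case: (cmonom_case d) => [->|[u ->]] ss; last by move=> _; rewrite mulcE; apply: Normal_dashv.
by move=> /(_ erefl) e; rewrite mulc1 -[X in normal _ _ X _]e; apply: Normal_self.
Qed.

Lemma dashv_nspan_lt f a B r : S f -> strong f -> lm f = Some a -> wbelow B r ->
  nspan_lt (word_mul (bword a) B) (dashv f r).
Proof.
move=> Sf sf e hr; apply: (mul_basis_mem (F := dashv f) (P := fun b => lt (bword b) B)) hr _.
- exact: span0.
- by move=> g h; apply: spanD.
- by move=> c g; apply: spanZ.
- by move=> g h; apply: dashvDr.
- by move=> c g; apply: dashvZr.
move=> b hb; rewrite (dashv_U1 f (erefl (bword b))).
apply: nspan_mem; first exact: normal_in_dashv.
apply: (supported_dashv1 (P := fun c => wle lt (bword c) (bword a))).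
  move=> c hc; have h := wle_mul2r Hlt (bword b) hc.
  by apply: (wle_lt_trans Hlt h); rewrite wlt_mul2l.
by move=> c /(lm_max Hlt e); apply: ble_word.
Qed.

(** For coprime leading words, expand [dashv f g = dashv g f] in the leading terms of
    the right factors: what remains are products of [f] and [g] by the tails, whose words
    are smaller. *)
Lemma coprime_nspan f g a b : S f -> S g -> strong f -> strong g ->
  lm f = Some a -> lm g = Some b ->
  nspan_lt (word_mul (bword a) (bword b))
    (dashv f (word1 k (bword b)) - dashv g (word1 k (bword a))).
Proof.
move=> Sf Sg sf sg ea eb.
have expand p q c : S q -> lm q = Some c ->
    dashv p (word1 k (bword c)) = dashv p q - dashv p (tail q).
  move=> Sq ec; rewrite {1}(tail_decomp ec) (proj1 GS _ Sq) dashvDr addrK.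
  by rewrite (dashv_U1 p (erefl (bword c))).
rewrite (expand _ _ _ Sg eb) (expand _ _ _ Sf ea) (dashvC g f).
rewrite opprB [X in nspan _ X]addrC addrA subrK; apply: spanD.
  by rewrite word_mulC; apply: dashv_nspan_lt => //; apply/(strong_tail Hlt ea).
by apply: spanN; apply: dashv_nspan_lt => //; apply/(strong_tail Hlt eb).
Qed.

(** The difference is a composition, and both terms are strong with the same leading
    monomial, so the words of the difference, and not just its monomials, lie below
    [W].  This gain is what survives multiplication by further letters. *)
Lemma overlap_nspan f g a b (w u v : {cmonom X}) W : S f -> S g -> strong f -> strong g ->
  lm f = Some a -> lm g = Some b -> bword a <> bword b ->
  (3 < mdeg (bword a) + mdeg (bword b))%N ->
  is_lcm (bword a : {cmonom X}) (bword b : {cmonom X}) w ->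
  w = mmul (bword a : {cmonom X}) u -> w = mmul (bword b : {cmonom X}) v ->
  v <> mone -> (mdeg w < mdeg (bword a) + mdeg (bword b))%N -> word_val W = w ->
  nspan_lt W (mulc f u - mulc g v).
Proof.
move=> Sf Sg sf sg ea eb ab d3 lw wu wv v1 dw eW.
have ia : u = mone -> lindex f = 1%N.
  (* Otherwise [f] has degree 2 and [g] degree 1, against [d3]. *)
  move=> u1; rewrite (lindexE ea); case: (bindexP a) => [[]//|[_ a2]].
  have v0 : (0 < mdeg v)%N by rewrite lt0n mdeg_eq0; apply/eqP.
  have := congr1 (@mdeg X) wv; rewrite wu u1 mulm1 mdegM a2 => e.
  move: d3; rewrite a2 -[3%N]/(2 + 1)%N ltn_add2l => b2.
  by have := leq_add b2 v0; rewrite -e.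
have nf := normal_mulc sf ia.
have ng : normal g v 1 (mulc g v) by apply: normal_mulc.
have [c [ec wc ic lf]] := normal_lm Hlt nf ea.
have [c' [ec' wc' ic' lg]] := normal_lm Hlt ng eb.
have cc : c' = c.
  apply: basis_eq; last by rewrite ic ic'.
  by apply: val_inj; rewrite /= wc wc' -wu -wv.
rewrite cc in ec'; have -> : W = bword c by apply: val_inj; rewrite /= eW wc.
apply: (composition_nspan_lt Sf Sg); last first.
  apply: (strong_sub ec ec'); first by rewrite lf lg !(proj1 GS).
  - exact: normal_strong nf sf.
  exact: normal_strong ng sg.
apply: (Comp_overlap (u := bword a) (v := bword b) (w := w) (a := u) (b := v)) => //.
- by rewrite (ldegE ea) (ldegE eb).
- by rewrite ea eb => -[] /(congr1 (@bword X)).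
- by rewrite /lword ea.
- by rewrite /lword eb.
by rewrite (ldegE ea) (ldegE eb).
Qed.

(** The overlap excluded by the degree condition on compositions of strong polynomials:
    a word of length 2 divisible by the generator leading [g].  Here the composition
    involves the normal [g]-polynomial of the same index as [f]; the choice of the index
    disappears after multiplication by a further word. *)
Lemma generator_nspan f g a b x : S f -> S g -> strong f ->
  lm f = Some a -> lm g = Some b -> mdeg (bword b) = 1%N ->
  bword a = word_mul (bword b) (word_gen x) ->
  exists p, nspan_lt (bword a) (f - p) /\
    forall u, dashv p (word1 k u) = dashv g (word1 k (word_mul (word_gen x) u)).
Proof.
move=> Sf Sg sf ea eb b1 ab; have dg : ldeg g = 1%N by rewrite (ldegE eb).
have sg := ldeg1_strong Hlt dg.
have a2 : mdeg (bword a) = 2%N by rewrite ab mdeg_word_mul b1 /= mdegU.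
suff [p [np pc]] : exists p, normal g (ucm x) (bindex a) p /\
    forall u, dashv p (word1 k u) = dashv g (word1 k (word_mul (word_gen x) u)).
  have [c [ec wc ic lp]] := normal_lm Hlt np eb.
  have ca : c = a by apply: basis_eq => //; apply: val_inj; rewrite /= wc ab.
  rewrite ca in ec; exists p; split=> //; apply: (composition_nspan_lt Sf Sg).
    by apply: (Comp_generator (x := x) (m := bindex a)); rewrite ?(ldegE ea) // ea ec.
  apply: (strong_sub ea ec) => //; first by rewrite lp !(proj1 GS).
  exact: normal_strong np sg.
case: (bindexP a) => -[-> _].
  exists (dashv g (gen k x)); split; last by move=> u; apply: dashvA1.
  exact: (Normal_dashv (word_gen x)).
exists (vdash g (gen k x)); split; last by move=> u; apply: vdash_dashvA1.
exact: Normal_vdash.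
Qed.

(** By [lcm_cofactors] the relation between the words is a multiple by [c] of the one
    given by the least common multiple, for which the difference is small by coprimality
    or by a composition.  Assuming that the leading word of [g] is not the longer one
    makes its cofactor nontrivial, as the composition demands. *)
Lemma distinct_words_nspan_le f g a b u v : (mdeg (bword b) <= mdeg (bword a))%N ->
  S f -> S g -> strong f -> strong g ->
  lm f = Some a -> lm g = Some b -> bword a <> bword b ->
  word_mul (bword a) u = word_mul (bword b) v ->
  nspan_lt (word_mul (bword a) u) (dashv f (word1 k u) - dashv g (word1 k v)).
Proof.
move=> le_ba Sf Sg sf sg ea eb ab e.
have [w [u0 [v0 [lw wu wv cof dw]]]] :=
  lcm_cofactors (bword a : {cmonom X}) (bword b : {cmonom X}).
have [c [uc vc]] := cof _ _ (congr1 (@word_val X) e).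
have v1 : v0 <> mone.
  move=> v1; case: ab; apply: val_inj; rewrite /= -[RHS]mulm1 -v1 -wv wu.
  suff -> : u0 = mone by rewrite mulm1.
  apply/mdeg_eq0I/eqP; rewrite -leqn0 -(leq_add2l (mdeg (bword a))) addn0.
  by rewrite -mdegM -wu wv v1 mulm1.
case: dw => [dw|[eu ev]]; last first.
  rewrite (mulc_sub f g uc vc) eu ev !mulcE.
  apply: nspan_lt_mulc (coprime_nspan Sf Sg sf sg ea eb).
  by rewrite /= uc eu mulmA.
have w0 : (0 < mdeg w)%N by rewrite wu mdegM addn_gt0 mdeg_gt0.
have [d3|d3] := ltnP 3 (mdeg (bword a) + mdeg (bword b)).
  rewrite (mulc_sub f g uc vc).
  apply: (nspan_lt_mulc (u := Word w0)); first by rewrite /= uc mulmA wu.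
  exact: (overlap_nspan Sf Sg sf sg ea eb ab d3 lw wu wv v1 dw).
have v0_gt0 : (0 < mdeg v0)%N by rewrite lt0n mdeg_eq0; apply/eqP.
have b1 : mdeg (bword b) = 1%N.
  move: d3 (mdeg_gt0 (bword b)) le_ba; case: (mdeg (bword b)) => [|[|n]] // d3 _ le_ba.
  by have := leq_trans (leq_add le_ba (leqnn n.+2)) d3; rewrite !addSn !addnS.
have wa : mdeg w = (mdeg (bword a) + mdeg u0)%N by rewrite wu mdegM.
have wb : mdeg w = (1 + mdeg v0)%N by rewrite wv mdegM b1.
have dw2 : (mdeg w <= mdeg (bword a))%N by move: dw; rewrite b1 addn1.
have u01 : u0 = mone.
  by apply/mdeg_eq0I/eqP; rewrite -leqn0 -(leq_add2l (mdeg (bword a))) addn0 -wa.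
have v01 : mdeg v0 = 1%N.
  apply/eqP; rewrite eqn_leq v0_gt0 andbT -(leq_add2l 1) -wb (leq_trans dw2) //.
  by move: d3; rewrite b1 addn1.
have [x vx] : exists x, v0 = ucm x.
  by have [x /(congr1 (@word_val X)) ex] := mdeg1_gen (w := Word v0_gt0) v01; exists x.
have awx : bword a = word_mul (bword b) (word_gen x).
  by apply: val_inj; rewrite /= -vx -wv wu u01 mulm1.
have [p [fp pc]] := generator_nspan Sf Sg sf ea eb b1 awx.
have uc' : word_val u = c by rewrite uc u01 mul1m.
have -> : v = word_mul (word_gen x) u by apply: val_inj; rewrite /= vc uc' vx.
by rewrite -pc -dashvBl; apply: nspan_lt_dashv.
Qed.

Lemma distinct_words_nspan f g a b u v : S f -> S g -> strong f -> strong g ->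
  lm f = Some a -> lm g = Some b -> bword a <> bword b ->
  word_mul (bword a) u = word_mul (bword b) v ->
  nspan_lt (word_mul (bword a) u) (dashv f (word1 k u) - dashv g (word1 k v)).
Proof.
have [le_ba|/ltnW le_ab] := leqP (mdeg (bword b)) (mdeg (bword a)).
  exact: distinct_words_nspan_le.
move=> Sf Sg sf sg ea eb ab e; rewrite -opprB e; apply: spanN.
by apply: (distinct_words_nspan_le _ _ _ _ _ eb ea) => //; apply/nesym.
Qed.

Lemma sub_cancel (V : zmodType) (x y z x' y' : V) :
  x = z + x' -> y = z + y' -> x - y = x' - y'.
Proof. by move=> -> ->; rewrite opprD addrACA subrr add0r. Qed.

(** If the leading monomials differ although the words agree, these words have length 2
    and the composition by a single letter [x] is available; the rest of [u] is handled
    by multiplication. *)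
Lemma same_word_nspan f g a b u : S f -> S g -> strong f -> strong g ->
  lm f = Some a -> lm g = Some b -> bword a = bword b ->
  nspan_lt (word_mul (bword a) u) (dashv f (word1 k u) - dashv g (word1 k u)).
Proof.
move=> Sf Sg sf sg ea eb ab; have l1 : lc f = lc g by rewrite !(proj1 GS).
have [e|nab] := eqVneq a b.
  rewrite -e in eb; rewrite -dashvBl; apply: nspan_lt_dashv.
  have [->|/eqP ne] := eqVneq f g; first by rewrite subrr; apply: span0.
  apply: (composition_nspan_lt Sf Sg); first by apply: Comp_same; rewrite ?ea ?eb.
  exact: strong_sub ea eb l1 sf sg.
have a2 : mdeg (bword a) = 2%N.
  case: (bindexP a) => -[ia a2] //; case: (bindexP b) => -[ib b2]; last by rewrite ab.
  by case/eqP: nab; rewrite a2 b2 ab.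
have one x : nspan_lt (word_mul (bword a) (word_gen x))
    (dashv f (word1 k (word_gen x)) - dashv g (word1 k (word_gen x))).
  apply: (composition_nspan_lt Sf Sg).
    apply: (Comp_same_word (x := x)) => //.
    - by rewrite (ldegE ea) (ldegE eb) -ab a2.
    - by rewrite ea eb => -[] /eqP; apply/negP.
    - by rewrite /lword ea eb /= ab.
    - exact: (Normal_dashv (word_gen x)).
    exact: (Normal_dashv (word_gen x)).
  have fx := dashv_tail (word_gen x) ea; have gx := dashv_tail (word_gen x) eb.
  rewrite -l1 -ab in gx; rewrite (sub_cancel fx gx) -dashvBl.
  apply: (supported_dashv1 (P := fun c => lt (bword c) (bword a))).
    by move=> c h; rewrite wlt_mul2r.
  apply: supportedB; first exact/(strong_tail Hlt ea).
  by rewrite ab; apply/(strong_tail Hlt eb).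
have [x [->//|[w [-> _]]]] := word_gen_split u.
rewrite word_mulA (_ : _ - _ = dashv
  (dashv f (word1 k (word_gen x)) - dashv g (word1 k (word_gen x))) (word1 k w)).
  exact: nspan_lt_dashv.
by rewrite dashvBl !dashvA1.
Qed.

Lemma vdash_nspan_lt f a B r : S f -> ldeg f = 1%N -> lm f = Some a -> wbelow B r ->
  nspan_lt (word_mul (bword a) B) (vdash f r).
Proof.
move=> Sf df e hr; have sf := ldeg1_strong Hlt df.
apply: (mul_basis_mem (F := vdash f) (P := fun b => lt (bword b) B)) hr _.
- exact: span0.
- by move=> g h; apply: spanD.
- by move=> c g; apply: spanZ.
- by move=> g h; apply: vdashDr.
- by move=> c g; apply: vdashZr.
move=> b hb; apply: nspan_mem; last first.
  apply: (supported_bilin (P := fun c => wle lt (bword c) (bword a)) (Q := eq b)).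
  - move=> c _ hc <-; have h := wle_mul2r Hlt (bword b) hc.
    by rewrite bword_vdash; apply: (wle_lt_trans Hlt h); rewrite wlt_mul2l.
  - by move=> c /(lm_max Hlt e); apply: ble_word.
  exact: supportedU.
case: (ltngtP (mdeg (bword b)) 1%N) => [|b2|/mdeg1_gen[x bx]].
- by rewrite ltnNge mdeg_gt0.
- rewrite vdashC vdash_dashv; last exact: supportedU.
  by rewrite dashvC (dashv_U1 f (erefl (bword b))); apply: normal_in_dashv.
suff -> : b = inl (word_gen x) by apply: normal_in_vdash.
apply: basis_eq => //; case: (bindexP b) => -[] // _.
by rewrite bx /= mdegU.
Qed.

(** The leading words are generators, so they are equal, and then [f - g] is a
    composition, or coprime, and then [vdash f g = vdash g f] moves the difference to the
    tails. *)
Lemma vdash_vdash_nspan f g a b x y : S f -> S g -> ldeg f = 1%N -> ldeg g = 1%N ->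
  lm f = Some a -> lm g = Some b ->
  word_mul (bword a) (word_gen x) = word_mul (bword b) (word_gen y) ->
  nspan_lt (word_mul (bword a) (word_gen x)) (vdash f (gen k x) - vdash g (gen k y)).
Proof.
move=> Sf Sg df dg ea eb e; have da := df; have db := dg.
rewrite (ldegE ea) in da; rewrite (ldegE eb) in db.
have a_inl c : mdeg (bword c) = 1%N -> c = inl (bword c).
  by case: (bindexP c) => -[// _ ->].
have [ab|/eqP ab] := eqVneq (bword a) (bword b).
  have exy : word_gen x = word_gen y.
    apply: val_inj; apply: (@mmulI _ (bword a)).
    by have := congr1 (@word_val X) e; rewrite ab.
  have gxy : gen k y = gen k x by rewrite /gen exy.
  rewrite gxy -vdashBl; apply: nspan_lt_vdash.
  have [->|/eqP ne] := eqVneq f g; first by rewrite subrr; apply: span0.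
  have eb' : lm g = Some a by rewrite eb (a_inl b db) -ab -(a_inl a da).
  apply: (composition_nspan_lt Sf Sg); first by apply: Comp_same; rewrite ?ea ?eb'.
  apply: strong_sub ea eb' _ (ldeg1_strong Hlt df) (ldeg1_strong Hlt dg).
  by rewrite !(proj1 GS).
have [w [a0 [b0 [lw wa wb cof dw]]]] :=
  lcm_cofactors (bword a : {cmonom X}) (bword b : {cmonom X}).
case: dw => [|[ea0 eb0]].
  rewrite da db ltnS => w1.
  have a01 : a0 = mone.
    by apply/mdeg_eq0I/eqP; move: w1; rewrite wa mdegM da -[X in (_ <= X)%N]addn0 leq_add2l leqn0.
  have b01 : b0 = mone.
    by apply/mdeg_eq0I/eqP; move: w1; rewrite wb mdegM db -[X in (_ <= X)%N]addn0 leq_add2l leqn0.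
  by case: ab; apply: val_inj; rewrite /= -[LHS]mulm1 -a01 -wa wb b01 mulm1.
have [c [xc yc]] := cof _ _ (congr1 (@word_val X) e).
have c1 : c = mone.
  apply/mdeg_eq0I/eqP; move: (congr1 (@mdeg X) xc).
  by rewrite /= mdegU mdegM ea0 db add1n => -[<-].
have ex : word_gen x = bword b by apply: val_inj; rewrite [LHS]xc c1 mulm1 ea0.
have ey : word_gen y = bword a by apply: val_inj; rewrite [LHS]yc c1 mulm1 eb0.
have genE d h u : lm h = Some d -> S h -> mdeg (bword d) = 1%N -> u = bword d ->
    word1 k u = h - tail h.
  move=> ed Sh dd ->; rewrite {1}(tail_decomp ed) (proj1 GS _ Sh) addrK /word1.
  by rewrite -(a_inl d dd).
have fx : vdash f (gen k x) = vdash f g - vdash f (tail g).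
  by rewrite /gen (genE _ _ _ eb Sg db ex) vdashBr.
have gy : vdash g (gen k y) = vdash f g - vdash g (tail f).
  by rewrite /gen (genE _ _ _ ea Sf da ey) vdashBr; exact: (congr1 (fun h => h - _) (vdashC g f)).
rewrite (sub_cancel fx gy) opprK addrC; apply: spanB.
  rewrite ex word_mulC; apply: vdash_nspan_lt => //.
  exact/(strong_tail Hlt ea)/ldeg1_strong.
rewrite ex; apply: vdash_nspan_lt => //.
exact/(strong_tail Hlt eb)/ldeg1_strong.
Qed.

Lemma composition_below f g p q a : S f -> S g -> normal_in p -> normal_in q ->
  lm p = Some a -> lm q = Some a -> composition lt f g (p - q) ->
  nspan (blt^~ a) (p - q).
Proof.
move=> Sf Sg np nq ep eq comp; apply: (composition_nspan _ Sf Sg comp).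
  exact: ble_below_down.
have [_ [_ lp]] := normal_in_lm np; have [_ [_ lq]] := normal_in_lm nq.
by apply: (below_sub Hlt ep eq); rewrite lp lq.
Qed.

(** In degree at least 3 this is an overlap with trivial cofactor on the side of [f]; in
    degree 2 it is the composition of [f] with a normal polynomial [dashv g x]. *)
Lemma self_dashv_nspan f g a u : S f -> S g -> strong g ->
  lm f = Some a -> lm (dashv g (word1 k u)) = Some a ->
  nspan (blt^~ a) (f - dashv g (word1 k u)).
Proof.
move=> Sf Sg sg ea; have [b eb] := monic_lm Sg.
have [-> _] := lm_dashv Hlt u eb sg; case=> ba.
have aw : bword a = word_mul (bword b) u by rewrite -ba.
have ia : bindex a = 1%N by rewrite -ba.
have eq : lm (dashv g (word1 k u)) = Some a by rewrite (lm_dashv Hlt u eb sg).1 ba.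
have sf := index1_strong Hlt ea ia.
apply: (composition_below Sf Sg) => //; [exact: normal_in_self|exact: normal_in_dashv|].
have ng := Normal_dashv u sg; have u1 := mdeg_gt0 u.
have da : ldeg f = (mdeg (bword b) + mdeg u)%N by rewrite (ldegE ea) aw mdeg_word_mul.
have [d3|d3] := ltnP 3 (ldeg f + ldeg g).
  apply: (Comp_overlap (u := bword a) (v := bword b) (w := bword a) (a := mone) (b := u)) => //.
  - by rewrite ea eb => -[] ab; move: (wlt_mulr Hlt (bword b) u); rewrite -aw ab wlt_irr.
  - by rewrite /lword ea.
  - by rewrite /lword eb.
  - by move=> ab; move: (wlt_mulr Hlt (bword b) u); rewrite -aw ab wlt_irr.
  - split=> [||w' [c ->] _]; [by exists mone; rewrite mulm1| |by exists c].
    by exists (u : {cmonom X}); rewrite aw.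
  - by rewrite mulm1.
  - by rewrite aw.
  - by move/(congr1 (@mdeg X)) => e; move: u1; rewrite e mdeg1.
  - by rewrite (ldegE eb) (ldegE ea) -[X in (X < _)%N]addn0 ltn_add2l mdeg_gt0.
  by rewrite -ia -(lindexE ea); apply: Normal_self.
have b1 : mdeg (bword b) = 1%N.
  move: d3 (mdeg_gt0 (bword b)); rewrite da (ldegE eb).
  case: (mdeg (bword b)) => [|[|n]] // d3 _.
  by move: d3; rewrite !addSn !addnS.
have m1 : mdeg u = 1%N.
  by apply/eqP; move: d3; rewrite da (ldegE eb) b1 addn1 !ltnS eqn_leq u1 andbT.
have [x ux] := mdeg1_gen m1; apply: (Comp_generator (x := x) (m := 1%N)).
- by rewrite da b1 m1.
- by rewrite (ldegE eb).
- by move: ng; rewrite ux.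
by rewrite eq.
Qed.

(** All ambiguities are resolved.  The nine cases are the possible shapes of [p] and [q];
    [vdash] never meets [dashv] because the indices of the leading monomials differ. *)
Lemma common_lm_nspan p q a : normal_in p -> normal_in q ->
  lm p = Some a -> lm q = Some a -> nspan (blt^~ a) (p - q).
Proof.
move=> np nq ep eq; have [f [d [m [Sf nf]]]] := np; have [g [e [n [Sg ng]]]] := nq.
have [b eb] := monic_lm Sf; have [c ec] := monic_lm Sg.
have [a1 [ep' wp ip _]] := normal_lm Hlt nf eb.
have ea1 : a1 = a by move: ep'; rewrite ep => -[].
have [a2 [eq' wq iq _]] := normal_lm Hlt ng ec.
have ea2 : a2 = a by move: eq'; rewrite eq => -[].
rewrite ea1 in wp ip; rewrite ea2 in wq iq.
have mn : m = n by rewrite -ip iq.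
case: (normal_cases nf) => [[d1 _ pf]|[x [dx m2 d1 pf]]|[u [du m1 sf pf]]];
case: (normal_cases ng) => [[e1 _ qg]|[y [ey n2 e1 qg]]|[v [ev n1 sg qg]]].
- have [->|/eqP ne] := eqVneq p q; first by rewrite subrr; apply: span0.
  rewrite -pf in Sf; rewrite -qg in Sg; apply: (composition_below Sf Sg) => //.
  by apply: Comp_same => //; rewrite ep eq.
- rewrite -pf in Sf; apply: (composition_below Sf Sg) => //.
  apply: (Comp_generator (x := y) (m := 2%N)) => //; last by rewrite ep eq.
    by rewrite (ldegE ep) wq ey mdegM mdegU -(ldegE ec) e1.
  by rewrite qg; apply: Normal_vdash.
- by rewrite -pf in Sf; rewrite qg; apply: self_dashv_nspan; rewrite -?qg.
- rewrite -qg in Sg; rewrite -opprB; apply: spanN; apply: (composition_below Sg Sf) => //.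
  apply: (Comp_generator (x := x) (m := 2%N)) => //; last by rewrite ep eq.
    by rewrite (ldegE eq) wp dx mdegM mdegU -(ldegE eb) d1.
  by rewrite pf; apply: Normal_vdash.
- have aw : word_mul (bword b) (word_gen x) = bword a by apply: val_inj; rewrite [RHS]wp dx.
  have aw' : word_mul (bword c) (word_gen y) = bword a by apply: val_inj; rewrite [RHS]wq ey.
  have h := vdash_vdash_nspan Sf Sg d1 e1 eb ec (etrans aw (esym aw')).
  by rewrite pf qg; apply: nspanW h => z; rewrite aw; apply: blt_word.
- by rewrite m2 n1 in mn.
- rewrite -qg in Sg; rewrite -opprB; apply: spanN; rewrite pf.
  by apply: self_dashv_nspan; rewrite -?pf.
- by rewrite m1 n2 in mn.
have aw : word_mul (bword b) u = bword a by apply: val_inj; rewrite [RHS]wp du.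
have aw' : word_mul (bword c) v = bword a by apply: val_inj; rewrite [RHS]wq ev.
suff h : nspan_lt (bword a) (p - q) by apply: nspanW h => z; apply: blt_word.
rewrite pf qg -aw; have [bc|/eqP bc] := eqVneq (bword b) (bword c).
  have -> : v = u.
    by apply: val_inj; apply: (@mmulI _ (bword b)); rewrite /= {1}bc -ev -wq wp du.
  exact: (same_word_nspan _ Sf Sg sf sg eb ec bc).
exact: (distinct_words_nspan Sf Sg sf sg eb ec bc (etrans aw (esym aw'))).
Qed.

(** All terms with leading monomial [a] can be merged into a multiple of one of them, at
    the cost of smaller terms, by [common_lm_nspan]. *)
Lemma nspan_top a f : nspan (ble lt ^~ a) f ->
  nspan (blt^~ a) f \/ exists p (c : k),
    [/\ normal_in p, lm p = Some a & nspan (blt^~ a) (f - c *: p)].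
Proof.
elim=> [|c p f' [np hp] _ IH]; first by left; apply: span0.
have [b [eb _]] := normal_in_lm np.
have [ba|nba] := eqVneq b a; last first.
  have hc : nspan (blt^~ a) (c *: p).
    apply: spanZ; apply: nspan_mem => // z /(lm_max Hlt eb) zb.
    apply: (ble_lt_trans Hlt zb); apply: ble_neq_lt nba.
    exact: hp (lm_in Hlt eb).
  case: IH => [h|[q [d [nq eq h]]]]; first by left; apply: spanD.
  by right; exists q, d; split=> //; rewrite -addrA; apply: spanD.
rewrite ba in eb; right; exists p.
case: IH => [h|[q [d [nq eq h]]]].
  by exists c; split=> //; rewrite addrC addrA addNr add0r.
exists (c + d); split; [exact: np|exact: eb|].
have hd := common_lm_nspan nq np eq eb.
rewrite (_ : _ - _ = (f' - d *: q) + d *: (q - p)).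
  by apply: spanD => //; apply: spanZ.
rewrite scalerBr addrA subrK scalerDl opprD addrA.
by rewrite [c *: p + f']addrC addrK.
Qed.

Lemma nspan_max (P : basis X -> Prop) f : nspan P f ->
  f = 0 \/ exists b, P b /\ nspan (ble lt ^~ b) f.
Proof.
elim=> [|c p f' [np hp] _ IH]; first by left.
have [b [eb _]] := normal_in_lm np; right; have Pb := hp _ (lm_in Hlt eb).
have hb d : ble lt b d -> nspan (ble lt ^~ d) (c *: p).
  move=> bd; apply: spanZ; apply: nspan_mem => // z /(lm_max Hlt eb) zb.
  exact: (ble_trans Hlt zb bd).
case: IH => [->|[d [Pd h]]].
  by exists b; rewrite addr0; split=> //; apply: hb; apply: ble_refl.
have [bd|db] := boolP (ble lt b d).
  by exists d; split=> //; apply: spanD => //; apply: hb.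
exists b; split=> //; apply: spanD; first by apply: hb; apply: ble_refl.
apply: nspanW h => z zd; rewrite /ble; apply/orP; right.
by apply: (ble_lt_trans Hlt zd); rewrite (bltNge Hlt).
Qed.

(** By induction on a bound for the monomials of the summands: either the merged term
    of [nspan_top] has a nonzero coefficient and leads [f], or the bound decreases. *)
Theorem composition_diamond f : Id S f -> f != 0 ->
  exists p, normal_in p /\ lm p = lm f.
Proof.
move=> If f0; suff main a : forall f, nspan (ble lt ^~ a) f -> f != 0 ->
    exists p, normal_in p /\ lm p = lm f.
  case: (nspan_max (Id_nspan If)) => [e|[a [_ h]]]; first by rewrite e eqxx in f0.
  exact: main h f0.
elim/(well_founded_ind (blt_wf Hlt)): a => a IH {If f0} {}f hf f0.
have below h : nspan (blt^~ a) h -> h != 0 -> exists p, normal_in p /\ lm p = lm h.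
  move=> /nspan_max[->|[b [ba hb]]]; first by rewrite eqxx.
  exact: IH ba _ hb.
case: (nspan_top hf) => [h|[p [c [np ep h]]]]; first exact: below.
have [c0|c0] := eqVneq c 0.
  by apply: below f0; move: h; rewrite c0 scale0r subr0.
exists p; split=> //; rewrite ep; apply/esym.
have [_ [_ lp]] := normal_in_lm np.
have cp : c *: p = << c *g a >> + c *: tail p.
  by rewrite {1}(tail_decomp ep) lp scalerDr scale_malgU mulr1.
have e : f = << c *g a >> + (c *: tail p + (f - c *: p)).
  by rewrite addrA -cp addrC subrK.
rewrite e; apply: (lmD Hlt c0 _).1; apply: supportedD; last exact: nspan_supported h.
by apply: supportedZ; apply: tail_below.
Qed.

End CompositionDiamond.

(** * Leading monomials of an ideal *)

Section LeadingBasis.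
Variables (k : fieldType) (X : choiceType) (lt : rel (word X)).
Hypothesis Hlt : monomial_order lt.
Local Notation D := (Di k X).
Local Notation blt := (basis_lt lt).
Local Notation lm := (@lm k X lt).
Local Notation lc := (@lc k X lt).
Local Notation strong := (@strong k X lt).
Local Notation ldeg := (@ldeg k X lt).
Local Notation normal := (@normal k X lt).
Local Notation normal_in := (@normal_in k X lt).
Implicit Types (f g h p q r s t : D) (a b c : basis X) (u v w : word X).
Implicit Types (S T I : D -> Prop).

Local Opaque dashv vdash basis_lt.

Definition lm_of s a := exists (d : {cmonom X}) m p, normal s d m p /\ lm p = Some a.

Definition lm_of_some S a := exists s, S s /\ lm_of s a.

Lemma lm_of_someE S a : lm_of_some S a <-> exists p, normal_in S p /\ lm p = Some a.
Proof.
split=> [[s [Ss [d [m [p [np e]]]]]]|[p [[s [d [m [Ss np]]]] e]]].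
  by exists p; split=> //; exists s, d, m.
by exists s; split=> //; exists d, m, p.
Qed.

(** The leading monomials of normal [s]-polynomials depend only on the leading monomial
    of [s] and on whether [s] is strong: besides [c] itself, a strong [s] covers the
    multiples of its leading word with index 1, and also those with index 2 when this
    word is a generator. *)
Lemma lm_ofE s a c : lm s = Some c ->
  lm_of s a <-> a = c \/ strong s /\ exists u,
    bword a = word_mul (bword c) u /\ (bindex a = 1%N \/ mdeg (bword c) = 1%N).
Proof.
move=> e; split=> [[d [m [p [np ep]]]]|].
  have [b [eb wb ib _]] := normal_lm Hlt np e.
  have ab : a = b by move: eb; rewrite ep => -[].
  rewrite -ab in wb ib; case: (normal_cases np) => [[_ _ ps]|[x [dx _ d1 _]]|[u [du m1 ss _]]].
  - by left; move: e; rewrite -ps ep => -[].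
  - right; split; first exact: ldeg1_strong.
    exists (word_gen x); split; last by right; rewrite -(ldegE e).
    by apply: val_inj; rewrite [LHS]wb dx.
  right; split=> //; exists u; split; last by left; rewrite ib.
  by apply: val_inj; rewrite [LHS]wb du.
case=> [->|[ss [u [wa ia]]]].
  by exists mone, (lindex lt s), s; split=> //; apply: Normal_self.
case: (bindexP a) => [[ia1 ea]|[ia2 a2]].
  exists (u : {cmonom X}), 1%N, (dashv s (word1 k u)); split; first exact: Normal_dashv.
  by rewrite (lm_dashv Hlt u e ss).1 ea wa.
case: ia => [ia|c1]; first by rewrite ia in ia2.
have u1 : mdeg u = 1%N by move: a2; rewrite wa mdeg_word_mul c1 add1n => -[].
have [x ux] := mdeg1_gen u1; have d1 : ldeg s = 1%N by rewrite (ldegE e).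
exists (ucm x), 2%N, (vdash s (gen k x)); split; first exact: Normal_vdash.
have [-> _ _] := lm_vdash Hlt x e d1; congr Some; apply: basis_eq.
  by rewrite bword_vdash wa ux.
by rewrite bindex_vdash /= mdegM mdegU c1 ia2.
Qed.

Lemma lm_of_ge s a c : lm s = Some c -> lm_of s a -> ble lt c a.
Proof.
move=> e /(lm_ofE _ e)[->|[_ [u [wa _]]]]; first exact: ble_refl.
by rewrite /ble blt_word ?orbT // wa wlt_mulr.
Qed.

Lemma lm_of_self s c : lm s = Some c -> lm_of s c.
Proof. by move=> e; apply/(lm_ofE _ e); left. Qed.

(** The form in which the algorithm handles a basis: unlike [GSB], it is visibly inherited
    by sets with the same covered monomials. *)
Definition leading_basis I S : Prop :=
  [/\ Defs.monic lt S, forall s, S s -> I s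
    & forall f a, I f -> lm f = Some a -> lm_of_some S a].

Lemma GSB_leading_basis S : GSB lt S -> leading_basis (Id S) S.
Proof.
move=> GS; split; first by case: GS.
  by move=> s; apply: Id_mem.
move=> f a If e; apply/lm_of_someE; rewrite -e.
exact: (composition_diamond Hlt GS If (lm_neq0 Hlt e)).
Qed.

(** Division with remainder zero: subtract a multiple of a normal polynomial with the
    same leading monomial and repeat. *)
Lemma leading_basis_nspan I S f a : is_ideal I -> leading_basis I S -> I f ->
  below_eq lt a f -> nspan lt S (ble lt ^~ a) f.
Proof.
move=> II [mS SI lead]; elim/(well_founded_ind (blt_wf Hlt)): a f => a IH f If fa.
case e: (lm f) => [b|]; last by rewrite (lm_None Hlt e); apply: span0.
have /lm_of_someE[p [np ep]] := lead _ _ If e.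
have [s [d [m [Ss nsp]]]] := np; have [c es] : exists c, lm s = Some c.
  by apply: lc_lm; rewrite mS // oner_neq0.
have [_ [_ _ _ lp]] := normal_lm Hlt nsp es; rewrite (mS _ Ss) in lp.
have ba : ble lt b a := fa _ (lm_in Hlt e).
have pa : below_eq lt a p by move=> z /(lm_max Hlt ep) zb; apply: ble_trans zb ba.
have := below_cancel Hlt e ep; rewrite lp divr1 -(lcE e) => hb.
rewrite -[f](subrK (lc f *: p)); apply: spanD; last by apply: spanZ; apply: span_mem.
have Ip : I p by apply: ideal_normal II (SI _ Ss) nsp.
have If' : I (f - lc f *: p) by apply: idealB => //; apply: idealZ.
case e' : (lm (f - lc f *: p)) => [z|]; last by rewrite (lm_None Hlt e'); apply: span0.
have zb := hb _ (lm_in Hlt e').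
have za : blt z a by case/orP: ba => [/eqP<-//|]; apply: blt_trans zb.
have h := IH z za _ If' (lm_max Hlt e').
by apply: nspanW h => y yz; rewrite /ble (ble_lt_trans Hlt yz za) orbT.
Qed.

Lemma leading_basis_GSB I S : is_ideal I -> leading_basis I S ->
  GSB lt S /\ forall f, Id S f <-> I f.
Proof.
move=> II LS; have [mS SI lead] := LS; split.
  split=> // f g h Sf Sg comp; have Ih := composition_ideal II (SI _ Sf) (SI _ Sg) comp.
  apply: (nspan_trivial Hlt); case e: (lm h) => [a|]; last by rewrite (lm_None Hlt e); apply: span0.
  by apply: nspanW (leading_basis_nspan II LS Ih (lm_max Hlt e)) => z; rewrite /lm_le /ble.
move=> f; split=> [If|If]; first exact: If.
case e: (lm f) => [a|]; last by rewrite (lm_None Hlt e); apply: ideal0; apply: Id_ideal.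
apply: (span_ideal (Id_ideal S)) (leading_basis_nspan II LS If (lm_max Hlt e)).
move=> p [[s [d [m [Ss np]]]] _]; apply: ideal_normal (Id_ideal S) _ np.
exact: Id_mem.
Qed.

(** Only [g] contains the lower basis element of the common leading word, so it survives
    in the difference, where nothing above it is left. *)
Lemma strong_mismatch f g a : lm f = Some a -> lm g = Some a -> lc f = lc g ->
  strong f -> ~~ strong g ->
  [/\ bindex a = 2%N, inl (bword a) \in msupp g & lm (f - g) = Some (inl (bword a))].
Proof.
move=> ef eg l sf ng; have [a' [eg' ia _ ga]] := nonstrong_lm Hlt (lm_neq0 Hlt eg) ng.
have ea : a' = a by move: eg'; rewrite eg => -[].
rewrite {}ea in ia ga; split=> //; apply: (lm_eq Hlt).
  rewrite -mcoeff_neq0 mcoeffB (_ : f@_(inl (bword a)) = 0) ?sub0r ?oppr_eq0 ?mcoeff_neq0 //.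
  apply: mcoeff_outdom; apply/negP => h.
  by move/(strong_index1 Hlt ef): sf => /(_ h); rewrite ia.
move=> b /(below_sub Hlt ef eg l); exact: blt_ble_index1.
Qed.

Lemma reducedP T t s a : reduced lt T -> T t -> a \in msupp t -> T s -> s <> t -> ~ lm_of s a.
Proof.
move=> rT Tt at_ Ts st [d [m [p [np ep]]]]; apply: (rT _ Tt _ at_ p _ ep).
by exists s, d, m.
Qed.

(** The normal [t]-polynomials do not cover [b] either, since their leading monomials are
    at least [a]. *)
Lemma reduced_tail T t a b : reduced lt T -> T t ->
  lm t = Some a -> b \in msupp t -> blt b a -> ~ lm_of_some T b.
Proof.
move=> rT Tt et bt ba [s [Ts sb]]; apply: (reducedP rT Tt bt Ts _ sb) => st.
rewrite st in sb; have := lm_of_ge et sb.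
by apply/negP; rewrite -(bltNge Hlt).
Qed.

Lemma monic_some I T t : leading_basis I T -> T t -> exists a, lm t = Some a.
Proof. by move=> [mT _ _] Tt; apply: lc_lm; rewrite mT // oner_neq0. Qed.

(** Two reduced bases have the same leading monomials: follow the leading monomial
    of [t] to a member [t'] of the other basis and back to [t'']; unless nothing
    moved, [t''] contradicts reducedness: if it is strong, it covers the leading monomial
    of [t], and otherwise [t' - t''] exposes a reducible monomial of [t'']. *)
Lemma reduced_lm I T T' t : is_ideal I -> leading_basis I T -> leading_basis I T' ->
  reduced lt T -> T t -> exists t', T' t' /\ lm t' = lm t.
Proof.
move=> II LT LT' rT Tt; have [mT TI leadT] := LT; have [mT' TI' leadT'] := LT'.
have [a et] := monic_some LT Tt; have [t' [Tt' t'a]] := leadT' _ _ (TI _ Tt) et.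
have [a' et'] := monic_some LT' Tt'; exists t'; split=> //; rewrite et et'.
have [t'' [Tt'' t''a']] := leadT _ _ (TI' _ Tt') et'.
have [a'' et''] := monic_some LT Tt''.
case/(lm_ofE _ et'): (t'a) => [->//|[st' [u [wa ia]]]].
have a'a : blt a' a by apply: blt_word; rewrite wa wlt_mulr.
have a''a := ble_lt_trans Hlt (lm_of_ge et'' t''a') a'a.
have tt : t'' <> t by move=> e; move: a''a; rewrite e et in et''; case: et'' => ->; rewrite blt_irr.
case: (reducedP rT Tt (lm_in Hlt et) Tt'' tt); apply/(lm_ofE _ et'').
case/(lm_ofE _ et''): (t''a') => [ea|[st'' [v [wa' ia']]]].
  right; split; last by exists u; rewrite -ea.
  apply/negPn/negP => ns; rewrite ea in et'.
  have l1 : lc t' = lc t'' by rewrite (mT _ Tt'') (mT' _ Tt').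
  have [i2 low lmd] := strong_mismatch et' et'' l1 st' ns.
  have Id : I (t' - t'') by apply: idealB => //; [apply: TI'|apply: TI].
  apply: (reduced_tail rT Tt'' et'' low _ (leadT _ _ Id lmd)).
  exact: (below_sub Hlt et' et'' l1) (lm_in Hlt lmd).
right; split=> //; exists (word_mul v u); rewrite wa wa' word_mulA; split=> //; left.
case: ia => // a1; have := mdeg_gt0 v; move: a1; rewrite wa' mdeg_word_mul.
by have := mdeg_gt0 (bword a''); case: (mdeg _) => [|n]; case: (mdeg _) => [|n'] //; rewrite addSn addnS.
Qed.

(** If [t] and [t'] have the same leading monomial, then that of [t - t'] would be a
    covered monomial in the support of one of them, below the leading one. *)
Theorem reduced_unique I T T' t : is_ideal I -> leading_basis I T -> leading_basis I T' ->
  reduced lt T -> reduced lt T' -> T t -> T' t.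
Proof.
move=> II LT LT' rT rT' Tt; have [mT TI leadT] := LT; have [mT' TI' leadT'] := LT'.
have [t' [Tt' ee]] := reduced_lm II LT LT' rT Tt.
suff -> : t = t' by [].
have [a et] := monic_some LT Tt; have et' := ee; rewrite et in et'.
case e: (lm (t - t')) => [b|]; last by move/(lm_None Hlt): e => /subr0_eq.
have It : I (t - t') by apply: idealB => //; [apply: TI|apply: TI'].
have l1 : lc t = lc t' by rewrite (mT _ Tt) (mT' _ Tt').
have bm := lm_in Hlt e; have ba := below_sub Hlt et et' l1 bm.
have := fsubsetP (msuppB_le t t') _ bm; rewrite in_fsetU => /orP[bt|bt].
  by case: (reduced_tail rT Tt et bt ba); apply: leadT It e.
by case: (reduced_tail rT' Tt' et' bt ba); apply: leadT' It e.
Qed.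

End LeadingBasis.

(** * Correctness of the algorithm *)

Section Algorithm.
Variables (k : fieldType) (X : choiceType) (lt : rel (word X)).
Hypothesis Hlt : monomial_order lt.
Local Notation D := (Di k X).
Local Notation blt := (basis_lt lt).
Local Notation lm := (@lm k X lt).
Local Notation lc := (@lc k X lt).
Local Notation strong := (@strong k X lt).
Implicit Types (f g h p q r s t : D) (a b c : basis X) (u v w : word X).
Implicit Types (S T I : D -> Prop).

Local Opaque dashv vdash basis_lt.


Lemma lm_of_mul s z b u c : lm s = Some c -> strong s -> lm_of lt s z ->
  bword b = word_mul (bword z) u -> bindex b = 1%N \/ mdeg (bword z) = 1%N ->
  lm_of lt s b.
Proof.
move=> e ss /(lm_ofE Hlt _ e) hz wb ib; apply/(lm_ofE Hlt _ e); right; split=> //.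
case: hz wb ib => [->|[_ [v [-> _]]]] wb ib; first by exists u.
exists (word_mul v u); rewrite wb word_mulA; split=> //; left; case: ib => //.
rewrite mdeg_word_mul => z1; have := leq_add (mdeg_gt0 (bword c)) (mdeg_gt0 v).
by rewrite z1.
Qed.

Lemma lm_of_index1_strong s z c : lm s = Some c -> lm_of lt s z -> bindex z = 1%N ->
  strong s.
Proof.
move=> e /(lm_ofE Hlt _ e)[->|[]//] ic; exact: (index1_strong Hlt e).
Qed.

Definition rem_fun S s : D -> Prop := fun t => S t /\ t <> s.

Definition lm_minimal S f := forall a, lm f = Some a -> ~ lm_of_some lt (rem_fun S f) a.

(** The difference [f - g] lies in the ideal and is led by the lower basis element of the
    common leading word, which neither [f] nor [g] covers; the member [t] covering it is
    strong because this element has index 1. *)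
Lemma strong_mismatch_cover I S f g a : is_ideal I -> leading_basis lt I S ->
  I f -> S g -> lc f = 1 -> lm f = Some a -> lm g = Some a -> strong f -> ~~ strong g ->
  exists t, [/\ bindex a = 2%N, inl (bword a) \in msupp g, S t, strong t
              & lm_of lt t (inl (bword a)) /\ forall h, lm h = Some a -> t <> h].
Proof.
move=> II LS If Sg lf ef eg sf ng; have [mS SI lead] := LS.
have l1 : lc f = lc g by rewrite lf (mS _ Sg).
have [ia ga e] := strong_mismatch Hlt ef eg l1 sf ng.
have [t [St ta]] := lead _ _ (idealB II If (SI _ Sg)) e.
have [c et] := monic_some LS St; exists t; split=> //.
  exact: (lm_of_index1_strong et ta).
split=> // h eh th; rewrite th in ta; have := lm_of_ge Hlt eh ta.
by apply/negP; rewrite -(bltNge Hlt); apply: (below_sub Hlt ef eg l1) (lm_in Hlt e).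
Qed.

(** The polynomial [g] covering the leading monomial of [f] also covers the other
    monomials covered by [f], except when both have the same leading monomial and only
    [f] is strong; then the member given by [strong_mismatch_cover] does. *)
Lemma prune_leading_basis I S f a : is_ideal I -> leading_basis lt I S -> S f ->
  lm f = Some a -> lm_of_some lt (rem_fun S f) a -> leading_basis lt I (rem_fun S f).
Proof.
move=> II LS Sf ef [g [[Sg gf] ga]]; have [mS SI lead] := LS.
split=> [s [Ss _]|s [Ss _]|h b Ih eh]; [exact: mS|exact: SI|].
have [s [Ss sb]] := lead _ _ Ih eh.
have [sf|/eqP sf] := eqVneq s f; last by exists s.
rewrite {s Ss}sf in sb; have [c eg] := monic_some LS Sg.
case/(lm_ofE Hlt _ ef): sb => [->|[sf [u [wb ib]]]]; first by exists g.
have [sg|ng] := boolP (strong g).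
  by exists g; split=> //; apply: (lm_of_mul eg sg ga wb ib).
have ac : a = c by case/(lm_ofE Hlt _ eg): ga => [//|[sg]]; rewrite sg in ng.
rewrite -ac in eg.
have [t [ia _ St st [ta tn]]] := strong_mismatch_cover II LS (SI _ Sf) Sg (mS _ Sf) ef eg sf ng.
have [d et] := monic_some LS St.
by exists t; split; [split=> //; apply: tn|apply: (lm_of_mul et st ta wb ib)].
Qed.

(** The properties of a remainder of [h] that the reductions preserve, together with
    irreducibility; by [remainder_unique] they determine it. *)
Record remainder I S h r : Prop := Remainder {
  rem_ideal : I r;
  rem_lm : lm r = lm h;
  rem_lc : lc r = 1;
  rem_irr : forall b, b \in msupp r -> ~ lm_of_some lt (rem_fun S h) b }.

Lemma remainder_unique I S h r r' : is_ideal I -> leading_basis lt I S -> S h ->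
  remainder I S h r -> remainder I S h r' -> r = r'.
Proof.
move=> II LS Sh [Ir er lr ir] [Ir' er' lr' ir'].
have [a ea] := monic_some LS Sh; rewrite ea in er er'.
case e: (lm (r - r')) => [b|]; last by move/(lm_None Hlt): e => /subr0_eq.
have bm := lm_in Hlt e; have [_ _ lead] := LS.
have [t [St tb]] := lead _ _ (idealB II Ir Ir') e.
have hb : lm_of_some lt (rem_fun S h) b.
  exists t; do !split=> //; move=> th; rewrite th in tb; have := lm_of_ge Hlt ea tb.
  apply/negP; rewrite -(bltNge Hlt).
  have l1 : lc r = lc r' by rewrite lr lr'.
  exact: (below_sub Hlt er er' l1 bm).
have := fsubsetP (msuppB_le r r') _ bm; rewrite in_fsetU => /orP[bt|bt].
  by case: (ir _ bt).
by case: (ir' _ bt).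
Qed.

(** Passing to a remainder can turn a polynomial into a strong one but not conversely:
    the lower basis element of its leading word would be reducible. *)
Lemma remainder_strong I S h r : is_ideal I -> leading_basis lt I S -> S h ->
  remainder I S h r -> strong h -> strong r.
Proof.
move=> II LS Sh [Ir er lr ir] sh; have [mS SI lead] := LS.
have [a ea] := monic_some LS Sh; rewrite ea in er; apply/negPn/negP => nr.
have l1 : lc h = lc r by rewrite lr (mS _ Sh).
have [ia ra e] := strong_mismatch Hlt ea er l1 sh nr.
case: (ir _ ra); have [t [St ta]] := lead _ _ (idealB II (SI _ Sh) Ir) e.
exists t; do !split=> //; move=> th; rewrite th in ta; have := lm_of_ge Hlt ea ta.
by apply/negP; rewrite -(bltNge Hlt); apply: (below_sub Hlt ea er l1) (lm_in Hlt e).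
Qed.

(** A remainder covers what its original covers, so the remainders form a leading basis.
    For reducedness, a monomial of [r] covered by another remainder [r'] is covered by
    some member of [S], which can only be the original [h] of [r] since [r] is
    irreducible; so it is the leading monomial of [h].  By minimality the original [h']
    of [r'] does not cover it, so only [r'] is strong, and [strong_mismatch_cover] gives
    a third member of [S] that covers it, against minimality. *)
Lemma remainders_reduced I S R : is_ideal I -> leading_basis lt I S ->
  (forall h, S h -> lm_minimal S h) ->
  (forall h, S h -> exists r, R r /\ remainder I S h r) ->
  (forall r, R r -> exists h, S h /\ remainder I S h r) ->
  leading_basis lt I R /\ reduced lt R.
Proof.
move=> II LS minS SR RS; have [mS SI lead] := LS; split.
  split=> [r /RS[h [_ []]]|r /RS[h [_ []]]|f b If ef] //.
  have [h [Sh hb]] := lead _ _ If ef; have [r [Rr hr]] := SR _ Sh; exists r; split=> //.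
  have [c ec] := monic_some LS Sh; have er : lm r = Some c by rewrite (rem_lm hr).
  apply/(lm_ofE Hlt _ er); case/(lm_ofE Hlt _ ec): hb => [|[sh w]]; [by left|right].
  by split=> //; apply: remainder_strong hr sh.
move=> r Rr a ar p [r' [d [m [[Rr' rr'] np]]]] ep.
have [h [Sh hr]] := RS _ Rr; have [h' [Sh' hr']] := RS _ Rr'.
have hh' : h' <> h by move=> e; rewrite e in hr'; case: rr'; apply: remainder_unique hr' hr.
have [c ec] := monic_some LS Sh; have [c' ec'] := monic_some LS Sh'.
have er : lm r = Some c by rewrite (rem_lm hr).
have er' : lm r' = Some c' by rewrite (rem_lm hr').
have r'a : lm_of lt r' a by exists d, m, p.
have Ip : I p by apply: ideal_normal II (rem_ideal hr') np.
have [t [St ta]] := lead _ _ Ip ep.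
have th : t = h.
  by apply: NNPP => th; case: (rem_irr hr ar); exists t.
rewrite {t St}th in ta; have ac : a = c.
  case/orP: (lm_max Hlt er ar) => [/eqP//|lt_ac].
  by have := lm_of_ge Hlt ec ta; move: lt_ac; rewrite (bltNge Hlt) => /negP.
rewrite {a ar ep ta}ac in r'a; have cover t : S t -> t <> h -> ~ lm_of lt t c.
  by move=> St th tc; apply: (minS _ Sh _ ec); exists t.
case/(lm_ofE Hlt _ er'): r'a => [cc|[sr' w]].
  by apply: (cover _ Sh' hh'); rewrite cc; apply: lm_of_self.
have [sh'|nh'] := boolP (strong h').
  by apply: (cover _ Sh' hh'); apply/(lm_ofE Hlt _ ec'); right.
have [t [ic' _ St st [tc' tn]]] := strong_mismatch_cover II LS (rem_ideal hr') Sh'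
  (rem_lc hr') er' ec' sr' nh'.
have [u [wc _]] := w; have [e et] := monic_some LS St.
apply: (cover t St); last by apply: (lm_of_mul et st tc' wc); case: w => v [_].
move=> th; rewrite th in tc'; have := lm_of_ge Hlt ec tc'; apply/negP.
by rewrite -(bltNge Hlt); apply: blt_word; rewrite wc wlt_mulr.
Qed.

(** ** Termination *)

(** A reduction of [f] either removes the leading monomial and makes [f] smaller, or it is a
    reduction of the tail.  So induct on the leading monomial and, for a fixed one, on
    the accessibility of the tail, which has a smaller leading monomial. *)
Lemma reduction_wf (G : {fset D}) f : (forall g, g \in G -> lc g = 1) ->
  Acc (fun f2 f1 => reduction_step lt G f1 f2) f.
Proof.
move=> mG; suff main a : forall f, below_eq lt a f ->
    Acc (fun f2 f1 => reduction_step lt G f1 f2) f.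
  case e: (lm f) => [a|]; first exact: main (lm_max Hlt e).
  constructor=> f' [g [b [m [p [a [_ _]]]]]].
  by rewrite (lm_None Hlt e) msupp0.
elim/(well_founded_ind (blt_wf Hlt)): a {f} => a IH f fa.
have below_acc h : below lt a h -> Acc (fun f2 f1 => reduction_step lt G f1 f2) h.
  move=> ha; case e: (lm h) => [b|]; first by apply: IH (lm_max Hlt e); apply: ha; apply: lm_in e.
  constructor=> h' [g [b [m [p [c [_ _]]]]]].
  by rewrite (lm_None Hlt e) msupp0.
case e: (lm f) => [b|]; last by apply: below_acc; rewrite (lm_None Hlt e); apply: supported0.
have /predU1P[ba|ba] : ble lt b a := fa _ (lm_in Hlt e); last first.
  by apply: below_acc => z /(lm_max Hlt e) zb; apply: ble_lt_trans zb ba.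
rewrite {b}ba in e; have := below_acc _ (tail_below Hlt e).
move tE: (tail lt f) => t acct; elim: acct f e tE {fa} => {}t _ IHt f e tE.
constructor=> f' [g [b [m [p [z [gG np zf ep ->]]]]]].
have [|c eg] := @lc_lm k X lt g; first by rewrite (mG _ gG) oner_neq0.
have [_ [_ _ _ lp]] := normal_lm Hlt np eg.
have [za|za] := eqVneq z a.
  rewrite za in ep *; apply: below_acc; have := below_cancel Hlt e ep.
  by rewrite lp.
have pa : below lt a p.
  move=> y /(lm_max Hlt ep) yz; apply: (ble_lt_trans Hlt yz).
  exact: ble_neq_lt (lm_max Hlt e zf) za.
have [e' _ t'] := sub_below_lead Hlt (f@_z / lc g) e pa.
apply: (IHt (tail lt f - (f@_z / lc g) *: p)) => //.
exists g, b, m, p, z.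
split; [exact: gG|exact: np|by rewrite -tE (msupp_tail _ e) za|exact: ep|].
by rewrite -tE (mcoeff_tail _ e) (negbTE za).
Qed.

Implicit Types (C H M G RG : {fset D}) (x y : state k X).

Lemma step_inv x y : step lt x y ->
  match x with
  | Prune C M =>
      [\/ exists f, [/\ f \in C, partially_reducible lt (M `\ f) f
                      & y = Prune (C `\ f) (M `\ f)],
          exists f, [/\ f \in C, ~ partially_reducible lt (M `\ f) f
                      & y = Prune (C `\ f) (f |` (M `\ f))]
        | C = fset0 /\ y = Collect M M fset0]
  | Collect H M RG =>
      (exists h, h \in H /\ y = Reduce (H `\ h) M RG (M `\ h) h)
      \/ H = fset0 /\ y = Return RG
  | Reduce H M RG G r =>
      (exists r', reduction_step lt G r r' /\ y = Reduce H M RG G r')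
      \/ ~ reducible lt G r /\ y = Collect H M (if r != 0 then r |` RG else RG)
  | Return _ => False
  end.
Proof.
case=> [C M f fC pr|C M f fC pr|M|H M RG h hH|H M RG G r r' rr'|H M RG G r ir|M RG].
- by apply: Or31; exists f.
- by apply: Or32; exists f.
- by apply: Or33.
- by left; exists h.
- by left; exists r'.
- by right.
by right.
Qed.

Lemma terminates_collect H M RG : (forall s, s \in M -> lc s = 1) ->
  terminates lt (Collect H M RG).
Proof.
move=> mM; have [n] := ubnP #|` H|; elim: n H RG => [|n IH] H RG Hn.
  by rewrite ltn0 in Hn.
constructor=> x /step_inv[[h [hH ->]]|[_ ->]]; last by constructor=> y /step_inv.
have cardH : (#|` H `\ h| < n)%N by move: Hn; rewrite (cardfsD1 h H) hH add1n ltnS.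
have mG g : g \in M `\ h -> lc g = 1 by rewrite in_fsetD1 => /andP[_ /mM].
move: (H `\ h) (M `\ h) cardH mG (reduction_wf h mG) => H' G cardH' _ acch.
elim: h / acch {hH} => r _ IHr; constructor=> y /step_inv[[r' [rr' ->]]|[_ ->]].
  exact: IHr.
exact: IH.
Qed.

Lemma terminates_prune C M : (forall s, s \in M -> lc s = 1) -> C `<=` M ->
  terminates lt (Prune C M).
Proof.
have [n] := ubnP #|` C|; elim: n C M => [|n IH] C M Cn mM CM.
  by rewrite ltn0 in Cn.
have cardC f : f \in C -> (#|` C `\ f| < n)%N.
  by move=> fC; move: Cn; rewrite (cardfsD1 f C) fC add1n ltnS.
constructor=> x /step_inv[[f [fC pr ->]]|[f [fC pr ->]]|[_ ->]].
- apply: IH; [exact: cardC| |exact: fsetSD].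
  by move=> s; rewrite in_fsetD1 => /andP[_ /mM].
- rewrite (fsetD1K (fsubsetP CM _ fC)); apply: IH (cardC _ fC) mM _.
  exact: fsubset_trans (fsubsetDl _ _) CM.
exact: terminates_collect.
Qed.

(** ** Invariants *)

Variable I : D -> Prop.
Hypothesis II : is_ideal I.

Lemma elements_rem M f g : elements (M `\ f) g <-> rem_fun (elements M) f g.
Proof.
rewrite /elements /rem_fun in_fsetD1; split=> [/andP[/eqP ne gM]|[gM /eqP ne]].
  by split.
by apply/andP.
Qed.

Lemma lm_of_someW S T a : (forall s, S s -> T s) -> lm_of_some lt S a -> lm_of_some lt T a.
Proof. by move=> ST [s [/ST Ts sa]]; exists s. Qed.

Lemma lm_of_rem M f a : lm_of_some lt (elements (M `\ f)) a <->
  lm_of_some lt (rem_fun (elements M) f) a.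
Proof. by split; apply: lm_of_someW => s /elements_rem. Qed.

Lemma partially_reducibleP M f : partially_reducible lt (M `\ f) f <->
  ~ lm_minimal (elements M) f.
Proof.
split=> [[a [p [ea np ep]]] mf|nm].
  by apply: (mf a ea); apply/lm_of_rem/lm_of_someE; exists p.
apply: NNPP => npr; apply: nm => a ea /lm_of_rem/lm_of_someE[p [np ep]].
by apply: npr; exists a, p.
Qed.

Lemma leading_basis_rem M f : elements M f -> leading_basis lt I (elements M) ->
  ~ lm_minimal (elements M) f -> leading_basis lt I (elements (M `\ f)).
Proof.
move=> fM LM /not_all_ex_not[a] nm; have [ea la] := imply_to_and _ _ nm.
have [mR RI lead] := prune_leading_basis II LM fM ea (NNPP _ la).
split=> [s /elements_rem/mR|s /elements_rem/RI|g b Ig eg] //.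
exact/lm_of_rem/(lead _ _ Ig eg).
Qed.

Definition minimal_basis M : Prop :=
  leading_basis lt I (elements M) /\ forall f, f \in M -> lm_minimal (elements M) f.

Definition collected H M RG : Prop :=
  (forall f, f \in M -> f \notin H -> exists2 r, r \in RG & remainder I (elements M) f r)
  /\ (forall r, r \in RG -> exists2 f, f \in M & remainder I (elements M) f r).

(** During the first loop the set remains a leading basis, and a polynomial that was kept
    stays minimal because later removals only shrink the set it is compared with.  The
    second loop does not change this minimal basis; while [h] is being reduced, its
    leading term is untouched, by minimality, and [RG] holds the remainders of the
    polynomials visited before [h]. *)
Definition invariant x : Prop :=
  match x with
  | Prune C M => [/\ leading_basis lt I (elements M), C `<=` M
      & forall f, f \in M -> f \notin C -> lm_minimal (elements M) f]
  | Collect H M RG => [/\ minimal_basis M, H `<=` M & collected H M RG]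
  | Reduce H M RG G r => exists h,
      [/\ minimal_basis M, h \in M, G = M `\ h, H `<=` M & collected (h |` H) M RG]
      /\ [/\ I r, lm r = lm h & lc r = 1]
  | Return RG => leading_basis lt I (elements RG) /\ reduced lt (elements RG)
  end.

Lemma invariant_prune C M y : invariant (Prune C M) -> step lt (Prune C M) y -> invariant y.
Proof.
case=> LM CM mins /step_inv[[f [fC pr ->]]|[f [fC pr ->]]|[C0 ->]].
- split=> [||g]; [|exact: fsetSD|].
    by apply: leading_basis_rem => //; [apply: (fsubsetP CM)|apply/partially_reducibleP].
  rewrite !in_fsetD1 => /andP[gf gM]; rewrite gf /= => gC a ea [s [[sM' sg] sa]].
  move/elements_rem: sM' => [sM _]; apply: (mins g gM gC a ea).
  by exists s.
- rewrite (fsetD1K (fsubsetP CM _ fC)); split=> // [|g gM gC].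
    exact: fsubset_trans (fsubsetDl _ _) CM.
  have [->|gf] := eqVneq g f.
    by apply: NNPP => /partially_reducibleP.
  by apply: mins => //; move: gC; rewrite in_fsetD1 gf.
split; [|exact: fsubset_refl|].
  by split=> // f fM; apply: mins => //; rewrite C0.
by split=> [f ->|r].
Qed.

Lemma invariant_collect H M RG y :
  invariant (Collect H M RG) -> step lt (Collect H M RG) y -> invariant y.
Proof.
case=> mM HM col /step_inv[[h [hH ->]]|[H0 ->]].
  exists h; have hM := fsubsetP HM _ hH; split; split=> //.
  - exact: fsubset_trans (fsubsetDl _ _) HM.
  - by rewrite fsetD1K.
  - by case: mM => -[_ MI _] _; apply: MI.
  by case: mM => -[mon _ _] _; apply: mon.
case: mM col => LM mins [c1 c2]; apply: (remainders_reduced II LM) => // [h hM|r rR].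
  by have [|r rR hr] := c1 _ hM; [rewrite H0|exists r].
by have [h hM hr] := c2 _ rR; exists h.
Qed.

Lemma invariant_reduce H M RG G r y :
  invariant (Reduce H M RG G r) -> step lt (Reduce H M RG G r) y -> invariant y.
Proof.
case=> h [[mM hM -> HM [c1 c2]] [Ir er lr]] /step_inv[[r' [rr' ->]]|[ir ->]].
  case: rr' => g [b [m [p [a [gG np ar ep ->]]]]].
  have [LM mins] := mM; have [_ MI _] := LM.
  have /elements_rem[gM gh] := gG; have [c ec] := monic_some LM hM.
  rewrite ec in er.
  have ac : blt a c.
    apply: ble_neq_lt (lm_max Hlt er ar) _; apply/eqP => ac.
    apply: (mins h hM c ec); exists g; split; first by split.
    by exists b, m, p; rewrite -ac.
  have pc : below lt c p.
    by move=> z /(lm_max Hlt ep) za; apply: (ble_lt_trans Hlt za ac).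
  have [er' lr' _] := sub_below_lead Hlt (r@_a / lc g) er pc.
  exists h; split; split=> //; [|by rewrite er'|by rewrite lr'].
  by apply: idealB => //; apply: idealZ => //; apply: ideal_normal np => //; apply: MI.
have r0 : r != 0.
  apply/eqP => r0; move: lr; rewrite r0 /Defs.lc lm0 //= => /eqP.
  by rewrite eq_sym oner_eq0.
rewrite r0; have hr : remainder I (elements M) h r.
  split=> // b br /lm_of_rem/lm_of_someE[p [np ep]]; apply: ir.
  by exists b, p.
split=> //; split=> [f fM fH|r']; last first.
  by rewrite in_fset1U => /predU1P[->|/c2//]; exists h.
have [->|fh] := eqVneq f h; first by exists r; rewrite // fset1U1.
have [|r' r'R fr'] := c1 f fM; first by rewrite in_fset1U negb_or fh.
by exists r' => //; rewrite in_fset1U r'R orbT.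
Qed.

Lemma invariant_step x y : invariant x -> step lt x y -> invariant y.
Proof.
case: x => [C M|H M RG|H M RG G r|RG].
- exact: invariant_prune.
- exact: invariant_collect.
- exact: invariant_reduce.
by move=> _ /step_inv.
Qed.

Lemma invariant_reachable x y : reachable lt x y -> invariant x -> invariant y.
Proof.
elim=> [{}x {}y xy ix|//|{}x {}y z _ IH1 _ IH2 ix]; first exact: invariant_step xy.
exact/IH2/IH1.
Qed.

Lemma progress x : (exists RG, x = Return RG) \/ exists y, step lt x y.
Proof.
case: x => [C M|H M RG|H M RG G r|RG]; last by left; exists RG.
- right; have [->|[f fC]] := fset_0Vmem C.
    by exists (Collect M M fset0); apply: Prune_end.
  have [pr|pr] := classic (partially_reducible lt (M `\ f) f).
    by exists (Prune (C `\ f) (M `\ f)); apply: Prune_drop.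
  by exists (Prune (C `\ f) (f |` (M `\ f))); apply: Prune_keep.
- right; have [->|[h hH]] := fset_0Vmem H; first by exists (Return RG); apply: Collect_end.
  by exists (Reduce (H `\ h) M RG (M `\ h) h); apply: Collect_pick.
right; have [[a [p [ar [g [b [m [gG np]]]] ep]]]|ir] := classic (reducible lt G r).
  exists (Reduce H M RG G (r - (r@_a / lc g) *: p)); apply: Reduce_step.
  by exists g, b, m, p, a.
by exists (Collect H M (if r != 0 then r |` RG else RG)); apply: Reduce_end.
Qed.

End Algorithm.

Theorem lemma32 (k : fieldType) (X : finType) (lt : rel (word X))
    (S : {fset (Di k X)}) :
  monomial_order lt ->
  GSB lt (elements S) ->
  terminates lt (start S) /\
  (forall t, reachable lt (start S) t ->
    (exists t', step lt t t') \/
    (exists RG : {fset (Di k X)},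
      [/\ t = Return RG,
          reduced_GSB_for lt (Id (elements S)) (elements RG)
        & forall T : Di k X -> Prop,
            reduced_GSB_for lt (Id (elements S)) T ->
            forall f, T f <-> elements RG f])).
Proof.
move=> Hlt GS; have II : is_ideal (Id (elements S)) by apply: Id_ideal.
split; first by apply: terminates_prune => //; case: GS.
move=> t st; have inv0 : invariant lt (Id (elements S)) (start S).
  split=> [||f fS]; [exact: GSB_leading_basis|exact: fsubset_refl|].
  by rewrite fS.
have := invariant_reachable Hlt II st inv0.
have [[RG ->] [LR rR]|step_t _] := progress lt t; last by left.
right; exists RG; have [GR IR] := leading_basis_GSB Hlt II LR.
split=> // T [GT rT IT] f.
have LT : leading_basis lt (Id (elements S)) T.
  have [mT TI lead] := GSB_leading_basis Hlt GT.
  by split=> [//|s /TI/IT//|g a /IT Ig]; apply: lead.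
by split; apply: (reduced_unique Hlt II).
Qed.
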